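(* Let $G$ be a countably infinite amenable group with a Følner sequence $F=(F_N)_{N\in\mathbb{N}}$. For every measure preserving system $(X,\mathcal{B},\mu,(T_g)_{g\in G})$ and every $B\in\mathcal{B}$ there exists a subset $A\subseteq G$ such that for all $k\in\mathbb{N}$ and all $h_1,\dots,h_k\in G$ the density $d_F(h_1A\cap\dots\cap h_kA)$ exists and $$d_F\left(h_1A\cap\dots\cap h_kA\right)=\mu\left(T_{h_1}B\cap\dots\cap T_{h_k}B\right).$$
   Context: A (left) Følner sequence in a countable group $G$ is a sequence $F=(F_N)_{N\in\mathbb{N}}$ of (nonempty) finite subsets of $G$ such that $\lim_{N\to\infty}\frac{|gF_N\Delta F_N|}{|F_N|}=0$ for all $g\in G$; $G$ is (left) amenable if it has a Følner sequence. For $E\subseteq G$, $d_F(E):=\lim_{N\to\infty}\frac{|E\cap F_N|}{|F_N|}$ when this limit exists. A measure preserving system $(X,\mathcal{B},\mu,(T_g)_{g\in G})$ is a probability space $(X,\mathcal{B},\mu)$ together with an action $(T_g)_{g\in G}$ of $G$ on $X$ by measure preserving maps $T_g:X\to X$ (so $T_g\circ T_h=T_{gh}$). $\mathbb{N}=\{1,2,\dots\}$. *)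

(* Defs.v *)
From HB Require Import structures.
From mathcomp Require Import all_boot all_order all_algebra.
From mathcomp Require Import finmap.
From mathcomp Require Import all_classical all_reals all_analysis.

Set Implicit Arguments.
Unset Strict Implicit.
Unset Printing Implicit Defensive.

Import Order.TTheory GRing.Theory Num.Theory.
Import numFieldNormedType.Exports.

Local Open Scope classical_set_scope.
Local Open Scope ring_scope.

Definition translate (G : groupType) (g : G) (E : set G) : set G :=
  [set (g * x)%g | x in E].

(* Only ever applied to finite sets: [fset_set] sends infinite sets to
   [fset0]. *)
Definition card_set (G : groupType) (E : set G) : nat := #|` fset_set E|%fset.

Record folner_sequence (R : realType) (G : groupType) (F : nat -> set G) :
    Prop := FolnerSequence {
  folner_finite : forall N, finite_set (F N) ;
  folner_nonempty : forall N, F N !=set0 ;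
  folner_invariant : forall g : G,
    (fun N => (card_set (translate g (F N) `+` F N))%:R
              / (card_set (F N))%:R : R) @ \oo --> (0 : R) }.

Definition density_seq (R : realType) (G : groupType) (F : nat -> set G)
    (E : set G) : nat -> R :=
  fun N => (card_set (E `&` F N))%:R / (card_set (F N))%:R.

Definition density_exists (R : realType) (G : groupType) (F : nat -> set G)
    (E : set G) : Prop := cvgn (density_seq R F E).

(* Meaningful only under [density_exists]. *)
Definition density (R : realType) (G : groupType) (F : nat -> set G)
    (E : set G) : R := limn (density_seq R F E).

Record measure_preserving_action (R : realType) (G : groupType)
    (d : measure_display) (X : measurableType d) (mu : probability X R)
    (T : G -> X -> X) : Prop := MeasurePreservingAction {
  mp_action1 : forall x, T 1%g x = x ;
  mp_actionM : forall g h x, T (g * h)%g x = T g (T h x) ;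
  mp_measurable : forall g, measurable_fun [set: X] (T g) ;
  mp_preserving : forall g (B : set X),
    measurable B -> mu (T g @^-1` B) = mu B }.

(* Main.v *)
(* Everything is reduced to constructing A with, for each finite H in G and all
   large N, | |A_H /\ F_N| - mu(B_H) |F_N| | <= eps |F_N|, where A_H and B_H are
   the intersections of the hA and of the T_h B (h in H).

   An Ornstein-Weiss greedy argument partitions G into tiles of bounded size such
   that every set E, up to eps |E| plus a multiple of its boundary, consists of
   points deep inside their tiles.  Put on each tile t the orbit pattern
   {g in t | T_g x_t in B}: for a mu-random x_t its deviation from the expected
   frequencies has mean zero, so in a finite set S the points x_t can be chosen
   one after the other, each having nonpositive inner product with the
   accumulated deviation; the total deviation is then O(sqrt |S|).  Using this on
   each tile S of a second, much coarser tiling gives, for given eps and finitely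
   many H, a set A whose deviation on every finite E is at most eps |E| plus a
   constant multiple of 1 + |boundary of E|.

   Finally eps tends to 0 along a sequence of such sets.  Two of them are glued
   by using the first on a finite union of tiles and the second elsewhere; a union
   of tiles has small boundary relative to every sufficiently invariant set, so no
   F_N sees the seam, and the threshold on N does not depend on the union chosen.
   Hence the successive modifications can be pushed off to infinity. *)

Require Import Defs.
From mathcomp Require Import all_boot all_order all_algebra.
From mathcomp Require Import finmap.
From mathcomp Require Import all_classical all_reals all_analysis.
From mathcomp Require Import lra ring.

Set Implicit Arguments.
Unset Strict Implicit.
Unset Printing Implicit Defensive.

Import Order.TTheory GRing.Theory Num.Theory.
Import numFieldNormedType.Exports.

Local Open Scope classical_set_scope.
Local Open Scope ring_scope.

(** * Counting points of finite sets *)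

Section Counting.
Variables (R : realType) (I : choiceType).
Implicit Types (E : {fset I}) (P Q : set I).

(** Real-valued and for an arbitrary predicate, so that counting estimates are linear inequalities
    over [R]. *)
Definition count_in E P : R := \sum_(x <- E) (x \in P)%:R.

Lemma count_in_ge0 E P : 0 <= count_in E P.
Proof. by apply: sumr_ge0 => x _; rewrite ler0n. Qed.

Lemma mem_natr_le P Q x : (P x -> Q x) -> (x \in P)%:R <= (x \in Q)%:R :> R.
Proof.
move=> PQ; rewrite ler_nat; case: (boolP (x \in P)) => // /set_mem/PQ Qx.
by rewrite mem_set.
Qed.

Lemma count_in_le E P Q :
  (forall x, x \in E -> P x -> Q x) -> count_in E P <= count_in E Q.
Proof.
move=> PQ; rewrite /count_in !big_seq; apply: ler_sum => x xE.
exact/mem_natr_le/PQ.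
Qed.

Lemma eq_count_in E P Q :
  (forall x, x \in E -> P x <-> Q x) -> count_in E P = count_in E Q.
Proof.
move=> PQ; apply/eqP; rewrite eq_le.
by apply/andP; split; apply: count_in_le => x xE /(PQ x xE).
Qed.

Lemma count_inT E : count_in E setT = #|` E|%:R.
Proof.
rewrite /count_in (eq_bigr (fun=> 1)); last by move=> x _; rewrite in_setT.
by rewrite big_const_seq count_predT iter_addr addr0.
Qed.

Lemma count_in_leT E P : count_in E P <= #|` E|%:R.
Proof. by rewrite -count_inT; apply: count_in_le. Qed.

Lemma count_inU E P Q : count_in E (P `|` Q) <= count_in E P + count_in E Q.
Proof.
rewrite /count_in -big_split /=; apply: ler_sum => x _.
rewrite in_setU; case: (x \in P); case: (x \in Q) => /=; lra.
Qed.

Lemma count_in_splitC E P Q : P `<=` Q ->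
  count_in E (Q `\` P) = count_in E Q - count_in E P.
Proof.
move=> PQ; rewrite /count_in -sumrB; apply: eq_bigr => x _.
rewrite in_setD; case: (boolP (x \in P)) => xP /=; last by rewrite subr0 andbT.
by rewrite andbF [x \in Q]mem_set ?subrr//; apply/PQ/set_mem.
Qed.

Lemma count_in_bigcup (J : choiceType) (L : {fset J}) E (P : J -> set I) :
  count_in E [set x | exists2 j, j \in L & P j x] <=
  \sum_(j <- L) count_in E (P j).
Proof.
rewrite /count_in exchange_big /=; apply: ler_sum => x _.
case: (boolP (x \in [set _ | _])) => [/set_mem[j jL Pjx]|_]; last first.
  by apply: sumr_ge0 => j _; rewrite ler0n.
rewrite (big_fsetD1 j) //= [x \in P j]mem_set // lerDl.
by apply: sumr_ge0 => k _; rewrite ler0n.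
Qed.

Lemma sum_count_in_disj (J : choiceType) (L : {fset J}) E (P : J -> set I) :
  (forall j k x, j \in L -> k \in L -> x \in E -> P j x -> P k x -> j = k) ->
  \sum_(j <- L) count_in E (P j) <= #|` E|%:R.
Proof.
move=> dis; rewrite -count_inT /count_in exchange_big /= !big_seq.
apply: ler_sum => x xE; rewrite in_setT.
have [[j jL Pjx]|nP] := pselect (exists2 j, j \in L & P j x); last first.
  rewrite big_seq big1 ?ler01// => j jL; case: (boolP (x \in P j)) => //.
  by move=> /set_mem Pjx; case: nP; exists j.
rewrite (big_fsetD1 j) //= big_seq big1 ?addr0; last first.
  move=> k; rewrite !inE => /andP[kj kL]; case: (boolP (x \in P k)) => //.
  by move=> /set_mem Pkx; rewrite (dis k j x) ?eqxx in kj.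
by case: (x \in P j).
Qed.

(** Comparison by injection. Applied with [f] a translation or the identity, it moves counts between
    a set and its translates. *)
Lemma sum_comp_le (J : choiceType) (L : {fset J}) E (f : J -> I) P
    (W : set J) : {in L &, injective f} ->
  (forall j, j \in L -> W j -> f j \in E /\ P (f j)) ->
  count_in E P >= \sum_(j <- L) (j \in W)%:R.
Proof.
move=> finj fE; pose LW := [fset j in L | j \in W]%fset.
have fEP x : x \in (f @` LW)%fset -> x \in E /\ P x.
  by case/imfsetP => j /=; rewrite !inE => /andP[jL /set_mem/(fE j jL)] ? ->.
have -> : \sum_(j <- L) (j \in W)%:R = \sum_(j <- LW) 1 :> R.
  rewrite big_fset /= [RHS]big_mkcond /=; apply: eq_bigr => j _.
  by case: (j \in W).
have -> : \sum_(j <- LW) 1 = \sum_(x <- (f @` LW)%fset) 1 :> R.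
  rewrite [RHS]big_imfset //= => j k; rewrite !inE => /andP[jL _] /andP[kL _].
  exact: finj.
rewrite /count_in [leRHS](big_fsetID _ [pred x | x \in (f @` LW)%fset]) /=.
rewrite -[leLHS]addr0; apply: lerD; last first.
  by apply: sumr_ge0 => x _; rewrite ler0n.
have -> : [fset x in E | x \in (f @` LW)%fset]%fset = (f @` LW)%fset.
  apply/fsetP => x; rewrite !inE /=; apply/andP/idP => [[]//|xf]; split=> //.
  by have [] := fEP x xf.
rewrite !big_seq; apply: ler_sum => x /fEP[_ Px].
by rewrite mem_set.
Qed.

End Counting.

(** * Boundaries and Folner sets *)

Section Boundary.
Variables (R : realType) (G : groupType).
Implicit Types (E K D : {fset G}) (P U : set G).

(* Intersected with E, this is the K-boundary of E. *)
Definition exits K E : set G := [set x | exists2 k, k \in K & (k * x)%g \notin E].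

Definition bd K E : R := count_in R E (exits K E).

Lemma bd_ge0 K E : 0 <= bd K E.
Proof. exact: count_in_ge0. Qed.

Lemma bd_sub K K' E : (K `<=` K')%fset -> bd K E <= bd K' E.
Proof.
by move=> /fsubsetP KK'; apply: count_in_le => x _ [k kK kx]; exists k => //; exact: KK'.
Qed.

Lemma sum_exits_le E L (delta : R) :
  (forall k, k \in L -> count_in R E [set x | (k * x)%g \notin E] <= delta) ->
  bd L E <= #|` L|%:R * delta.
Proof.
move=> Ldelta; apply: (le_trans (count_in_bigcup _ _ _ _)).
rewrite big_seq (le_trans (ler_sum _ Ldelta)) // -big_seq.
by rewrite big_const_seq count_predT iter_addr addr0 mulr_natl.
Qed.

End Boundary.

Section Folner.
Variables (R : realType) (G : groupType) (F : nat -> set G).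
Hypothesis F_folner : folner_sequence R F.

Definition fF N := fset_set (F N).

Lemma mem_fF N x : (x \in fF N) = (x \in F N).
Proof. by rewrite in_fset_set//; exact: folner_finite F_folner N. Qed.

Lemma fF_card_gt0 N : 0 < #|` fF N|%:R :> R.
Proof.
rewrite ltr0n cardfs_gt0; have [x Fx] := folner_nonempty F_folner N.
by apply/fset0Pn; exists x; rewrite mem_fF mem_set.
Qed.

(** If [x] lies in [F N] but [g * x] does not, then [g * x] lies in the symmetric difference, and
    left translation is injective. *)
Lemma folner_count_near (g : G) (delta : R) : 0 < delta ->
  \forall N \near \oo,
    count_in R (fF N) [set x | (g * x)%g \notin fF N] <= delta * #|` fF N|%:R.
Proof.
move=> d0; have := folner_invariant F_folner g.
move=> /cvgrPdist_le /(_ _ d0); apply: filterS => N.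
rewrite sub0r normrN ger0_norm ?divr_ge0// ler_pdivrMr; last exact: fF_card_gt0.
apply: le_trans; set S := translate g (F N) `+` F N.
have finS : finite_set S.
  have fin := folner_finite F_folner N.
  by rewrite /S /setY finite_setU; split; apply: finite_setD => //; exact: finite_image.
rewrite /card_set -(count_inT R (fset_set S)).
have /(_ setT) := @sum_comp_le R G G (fF N) (fset_set S) (fun x => (g * x)%g).
apply; first by move=> x y _ _; exact: mulgI.
move=> x; rewrite mem_fF => /set_mem Fx /= gx; split => //.
rewrite in_fset_set// mem_set//; left; split; first by exists x.
by move=> Fgx; move/negP: gx; apply; rewrite mem_fF mem_set.
Qed.

Lemma folner_bd_near K (delta : R) : 0 < delta ->
  \forall N \near \oo, bd R K (fF N) <= delta * #|` fF N|%:R.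
Proof.
(* The [+ 1] keeps the divisor positive when [K] is empty. *)
move=> d0; pose n := #|` K|%:R + 1 : R.
have n0 : 0 < n by rewrite /n ltr_wpDl.
have : \forall N \near \oo, forall k, k \in K ->
    count_in R (fF N) [set x | (k * x)%g \notin fF N] <= (delta / n) * #|` fF N|%:R.
  (* The tolerance is generalized first, so that it does not change as elements are removed from
     [K]. *)
  elim/finSet_rect: K {n n0} (delta / n) (divr_gt0 d0 n0) => K IH e e0.
  have [->|/fset0Pn[k kK]] := eqVneq K fset0.
    by near=> N => k; rewrite in_fset0.
  have := IH (K `\ k)%fset (fproperD1 kK) e e0.
  apply: filterS2 (folner_count_near k e0) => N Hk HK k'.
  by have [->//|nk k'K] := eqVneq k' k; apply: HK; rewrite !inE nk.
apply: filterS => N /sum_exits_le /le_trans; apply.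
rewrite mulrA ler_wpM2r// mulrA mulrC -ler_pdivlMl ?invr_gt0// invrK /n.
have : 0 <= #|` K|%:R :> R by []. nra.
Unshelve. all: by end_near.
Qed.

(** A right translate of some [F N] contains the identity, and right translations commute with left
    multiplication by [K], so the boundary count is kept. These sets [D] are the tile shapes. *)
Lemma folner_shape K (delta : R) : 0 < delta ->
  exists2 D : {fset G}, 1%g \in D & bd R K D <= delta * #|` D|%:R.
Proof.
move=> d0; have /filter_ex[N HN] := folner_bd_near K d0.
have [x0 Fx0] := folner_nonempty F_folner N.
pose f (x : G) := (x * x0^-1)%g; pose D := (f @` fF N)%fset.
have f_inj : injective f by exact: mulIg.
have fD x : (f x \in D) = (x \in fF N).
  apply/imfsetP/idP => [[y /= yF /f_inj->]//|xF]; by exists x.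
exists D; first by rewrite -(mulgV x0) fD mem_fF mem_set.
suff -> : bd R K D = bd R K (fF N) by rewrite card_imfset.
rewrite /bd /count_in big_imfset /=; last by move=> x y _ _; exact: f_inj.
apply: eq_bigr => x _; congr (nat_of_bool _)%:R.
apply/idP/idP => /set_mem[k kK kx]; apply/mem_set; exists k => //.
  by rewrite -fD /f -mulgA.
by rewrite /f mulgA fD.
Qed.

(** Once the [K]-boundary is at most half of [F N], some translate [K x] lies inside [F N], which
    then has at least as many elements as [K]. *)
Lemma folner_card_near (G_infinite : infinite_set [set: G]) n :
  \forall N \near \oo, n%:R <= #|` fF N|%:R :> R.
Proof.
have [K _ Kn] := infinite_set_fset n G_infinite.
have h0 : 0 < 2^-1 :> R by rewrite invr_gt0.
apply: filterS (folner_bd_near K h0) => N HN.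
have [x xF Kx] : exists2 x, x \in fF N & forall k, k \in K -> (k * x)%g \in fF N.
  apply: contrapT => nx; suff : bd R K (fF N) = #|` fF N|%:R.
    by have := fF_card_gt0 N => c0 e; move: HN; rewrite e; lra.
  rewrite /bd -count_inT; apply: eq_count_in => x xF; split=> // _.
  apply: contrapT => nk; apply: nx; exists x => // k kK.
  by apply/negPn/negP => kx; apply: nk; exists k.
rewrite ler_nat (leq_trans Kn)//.
have <- : #|` [fset (k * x)%g | k in K]%fset| = #|` K|.
  by rewrite card_imfset //=; exact: mulIg.
by apply: fsubset_leq_card; apply/fsubsetP => y /imfsetP[k /= kK ->]; exact: Kx.
Qed.

End Folner.

(** * Ornstein-Weiss quasi-tilings *)

Section Tiling.
Variables (R : realType) (G : groupType).
Implicit Types (E K D : {fset G}) (P U V : set G) (la : G -> {fset G}).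

(** A partition, encoded by the map sending a point to its tile. The tile of [x] lies in [K x];
    hence if it is not contained in [E], its points in [E] all belong to the [K]-boundary of [E]. *)
Record tiling la K : Prop := Tiling {
  tiling_refl : forall x, x \in la x ;
  tiling_eq : forall x y, y \in la x -> la y = la x ;
  tiling_bounded : forall x y, y \in la x -> (y * x^-1)%g \in K }.

(** Since [E] contains the tiles of its points, it is a disjoint union of tiles and both sums
    regroup tile by tile. *)
Lemma tile_sum la K E (f w : G -> R) : tiling la K ->
  (forall x, x \in E -> (la x `<=` E)%fset) ->
  (forall x, x \in E -> `|\sum_(y <- la x) f y| <= \sum_(y <- la x) w y) ->
  `|\sum_(x <- E) f x| <= \sum_(x <- E) w x.
Proof.
move=> tla laE fw.
have tileE (h : G -> R) x : x \in E ->
    \sum_(i <- E | la i == la x) h i = \sum_(i <- la x) h i.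
  move=> xE; rewrite big_fset_condE; apply: eq_fbigl => y.
  rewrite !inE /=; apply/andP/idP => [[_ /eqP <-]|ylx].
    exact: tiling_refl tla y.
  by rewrite (fsubsetP (laE _ xE)) //= (tiling_eq tla ylx).
rewrite 2!(partition_big_imfset _ la) /=.
rewrite (le_trans (ler_norm_sum _ _ _))// !big_seq; apply: ler_sum => t.
by move=> /imfsetP[x /= xE ->]; rewrite !tileE //; exact: fw.
Qed.

(** The outer [K]-boundary of [U]. *)
Definition enters K U : set G := [set x | ~ U x /\ exists2 k, k \in K & U (k * x)%g].

(* U is the part tiled so far; the points outside U are singleton tiles, and
   [theta] bounds their density.  [qt_bd] keeps the boundary of U small, which the
   next, finer generation of tiles needs in order to fill a fixed proportion of
   the complement. *)
Record quasi_tiling (K0 K' : {fset G}) (rho delta theta : R) la U K (C : R) :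
    Prop := QuasiTiling {
  qt_tiling : tiling la K ;
  qt_C : 0 <= C ;
  qt_out : forall x, ~ U x -> la x = [fset x]%fset ;
  qt_inv : forall x, U x ->
    count_in R (la x) (exits K0 (la x)) <= rho * #|` la x|%:R ;
  qt_bd : forall E,
    count_in R E (enters K' U) <= delta * #|` E|%:R + C * bd R K E ;
  qt_cov : forall E,
    count_in R E (~` U) <= theta * #|` E|%:R + C * bd R K E }.

(** * Greedy selection of one generation of tiles *)

Section Greedy.
Variables (idx : G -> nat) (idx_inj : injective idx).
Variables (D : {fset G}) (eta : R) (U : set G).
Hypotheses (eta_gt0 : 0 < eta) (eta_half : eta <= 2^-1) (D1 : 1%g \in D).

Definition sparse V (c : G) : bool :=
  count_in R D [set d | V (d * c)%g] < eta * #|` D|%:R.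

(* The candidates D c are examined in the order [idx] of their centers c; D c is
   accepted when less than a fraction [eta] of it is already covered. *)
Fixpoint greedy n : set G :=
  if n is m.+1 then greedy m `|`
    [set x | exists c, [/\ idx c = m, sparse (greedy m) c &
                          exists2 d, d \in D & x = (d * c)%g]]
  else U.

Definition added c := sparse (greedy (idx c)) c.
Definition new_tile c : {fset G} :=
  [fset x in ((fun d => (d * c)%g) @` D)%fset | x \notin greedy (idx c)]%fset.
Definition greedy_union : set G := [set x | exists n, greedy n x].

Lemma mem_new_tile c x :
  x \in new_tile c <-> (exists2 d, d \in D & x = (d * c)%g) /\ ~ greedy (idx c) x.
Proof.
rewrite !inE /=; split=> [/andP[/imfsetP[d /= dD ->] nx]|[[d dD ->] nx]].
  by split; [exists d|move=> /mem_set; apply/negP].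
apply/andP; split; first by apply/imfsetP; exists d.
by apply/negP => /set_mem.
Qed.

Lemma greedy_mono m n : (m <= n)%N -> greedy m `<=` greedy n.
Proof.
move=> /subnK <-; elim: (n - m)%N => [|k IH] //= x /IH; by left.
Qed.

Lemma greedy_sub_union n : greedy n `<=` greedy_union.
Proof. by move=> x; exists n. Qed.

Lemma added_sub c d : added c -> d \in D -> greedy (idx c).+1 (d * c)%g.
Proof. by move=> ac dD; right; exists c; split=> //; exists d. Qed.

Lemma added_sub_union c d : added c -> d \in D -> greedy_union (d * c)%g.
Proof. by move=> ac dD; exists (idx c).+1; exact: added_sub. Qed.

Lemma new_tile_union c x : added c -> x \in new_tile c -> greedy_union x.
Proof. by move=> ac /mem_new_tile[[d dD ->] _]; exact: added_sub_union. Qed.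

Lemma new_tile_disj c x : x \in new_tile c -> ~ U x.
Proof.
by move=> /mem_new_tile[_ nx] Ux; apply: nx; exact: (@greedy_mono 0).
Qed.

Lemma greedy_unionP x : greedy_union x -> ~ U x ->
  exists2 c, added c & x \in new_tile c.
Proof.
move=> [n]; elim: n => [//|n IH] Wx nU.
have [/IH/(_ nU)//|nW] := pselect (greedy n x).
case: Wx => [//|[c [ic sc [d dD xE]]]]; exists c; first by rewrite /added ic.
by apply/mem_new_tile; split; [exists d|rewrite ic].
Qed.

(** Of two accepted centers, the one examined later removes from its tile all that the earlier one
    covers; injectivity of [idx] excludes ties. *)
Lemma new_tile_inj c c' x : added c -> added c' ->
  x \in new_tile c -> x \in new_tile c' -> c = c'.
Proof.
move=> ac ac' /mem_new_tile[[d dD xd] nx] /mem_new_tile[[d' dD' xd'] nx'].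
apply: idx_inj; apply/eqP; case: ltngtP => // lt.
- by case: nx'; apply: (greedy_mono lt); rewrite xd; exact: added_sub.
- by case: nx; apply: (greedy_mono lt); rewrite xd'; exact: added_sub.
Qed.

Lemma card_new_tile c : added c -> (1 - eta) * #|` D|%:R <= #|` new_tile c|%:R :> R.
Proof.
rewrite /added /sparse => sc.
have h : count_in R D [set d | ~ greedy (idx c) (d * c)%g] <=
    count_in R (new_tile c) setT.
  apply: (sum_comp_le _ (f := fun d => (d * c)%g)); first by move=> ? ? _ _; exact: mulIg.
  by move=> d dD nd; split=> //; apply/mem_new_tile; split => //; exists d.
rewrite count_inT in h; apply: le_trans h.
have <- : count_in R D (setT `\` [set d | greedy (idx c) (d * c)%g])
    = count_in R D [set d | ~ greedy (idx c) (d * c)%g].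
  by apply: eq_count_in => d _; split=> [[]//|].
rewrite count_in_splitC// count_inT; move: sc; lra.
Qed.

Lemma card_D_gt0 : 0 < #|` D|%:R :> R.
Proof. by rewrite ltr0n cardfs_gt0; apply/fset0Pn; exists 1%g. Qed.

(** Either [c] was accepted and all of [D c] is covered, or it was rejected because a fraction [eta]
    of [D c] was already covered. *)
Lemma greedy_maximal c :
  eta * #|` D|%:R <= count_in R D [set d | greedy_union (d * c)%g].
Proof.
have D0 := card_D_gt0; case: (boolP (added c)) => [ac|].
  apply: (@le_trans _ _ #|` D|%:R); first by rewrite ler_piMl ?ltW//; move: eta_half; lra.
  by rewrite -count_inT; apply: count_in_le => d dD _; exact: added_sub_union.
rewrite /added /sparse -leNgt => /le_trans; apply.
by apply: count_in_le => d _ /=; exact: greedy_sub_union.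
Qed.

(** Up to boundary terms, one generation covers a fraction [eta] of what was uncovered. Pairs
    [(d, c)] with [d * c] newly covered are counted twice: each [c] in [W] has at least [eta * #|D|]
    partners, and for each [d] the points [d * c] are distinct newly covered points of [E]. *)
Lemma greedy_cover E :
  count_in R E (~` greedy_union) <=
  (1 - eta) * count_in R E (~` U) + eta * bd R D E + eta * count_in R E (enters D U).
Proof.
(* Centers whose whole translate [D c] stays inside [E] and outside [U]. *)
pose W := [set c | [/\ ~ U c, ~ exits D E c & ~ enters D U c]].
have UU : U `<=` greedy_union by exact: (@greedy_sub_union 0).
have hW : count_in R E (~` U) <= count_in R E W + (bd R D E + count_in R E (enters D U)).
  apply: (@le_trans _ _ (count_in R E (W `|` (exits D E `|` enters D U)))).
    apply: count_in_le => x xE nU.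
    have [|h1] := pselect (exits D E x); first by right; left.
    have [|h2] := pselect (enters D U x); first by right; right.
    by left.
  apply: (le_trans (count_inU _ _ _ _)); rewrite lerD2l; exact: count_inU.
pose N := greedy_union `\` U.
have h1 : eta * #|` D|%:R * count_in R E W <= #|` D|%:R * count_in R E N.
  have -> : #|` D|%:R * count_in R E N = \sum_(d <- D) count_in R E N.
    by rewrite big_const_seq count_predT iter_addr addr0 mulr_natl.
  apply: (@le_trans _ _ (\sum_(d <- D) \sum_(c <- E) (c \in [set c | W c /\ N (d * c)%g])%:R)).
    rewrite exchange_big /= [leLHS]mulr_sumr; apply: ler_sum => c _.
    case: (boolP (c \in W)) => [/set_mem Wc|_]; last first.
      by rewrite mulr0; apply: sumr_ge0 => d _; rewrite ler0n.
    rewrite mulr1; apply: (le_trans (greedy_maximal c)).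
    rewrite /count_in !big_seq; apply: ler_sum => d dD; rewrite ler_nat.
    case: (boolP (d \in _)) => // /set_mem /= gd; rewrite [c \in _]mem_set// /=.
    split=> //; split=> // Ud; case: Wc => nU _ nent; apply: nent; split=> //.
    by exists d.
  rewrite !big_seq; apply: ler_sum => d dD.
  apply: (sum_comp_le _ (f := fun c => (d * c)%g)); first by move=> ? ? _ _; exact: mulgI.
  move=> c cE [[_ nex _] Nc]; split=> //; apply/negPn/negP => dc.
  by apply: nex; exists d.
have h2 : eta * count_in R E W <= count_in R E N.
  by rewrite -(ler_pM2l card_D_gt0) mulrA [_ * eta]mulrC.
have h3 : count_in R E N = count_in R E (~` U) - count_in R E (~` greedy_union).
  rewrite -count_in_splitC; last by move=> x nx /UU.
  apply: eq_count_in => x _; split=> [[gx nU]|[nU /contrapT gx]]; by split.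
have : eta * count_in R E (~` U) <=
    eta * (count_in R E W + (bd R D E + count_in R E (enters D U))).
  by rewrite ler_pM2l.
move: h2; rewrite h3; lra.
Qed.

End Greedy.

End Tiling.

Section Products.
Variable G : groupType.
Implicit Types A B : {fset G}.

Definition finv A : {fset G} := [fset (a^-1)%g | a in A]%fset.
Definition fmul A B : {fset G} := [fset (a * b)%g | a in A, b in B]%fset.

Lemma mem_finv A a : a \in A -> (a^-1)%g \in finv A.
Proof. by move=> aA; apply/imfsetP; exists a. Qed.

Lemma mem_fmul A B a b : a \in A -> b \in B -> (a * b)%g \in fmul A B.
Proof. by move=> aA bB; apply/imfset2P; exists a => //; exists b. Qed.

End Products.

(** * Iterating the greedy selection, from coarse to fine tiles *)

Section QuasiTilings.
Variables (R : realType) (G : groupType).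
Implicit Types (E K D : {fset G}) (P U V : set G) (la : G -> {fset G}).
Variables (idx : G -> nat) (idx_inj : injective idx).
Hypothesis shape : forall K (delta : R), 0 < delta ->
  exists2 D : {fset G}, 1%g \in D & bd R K D <= delta * #|` D|%:R.
Variables (K0 : {fset G}) (eta rho sigma : R).
Hypotheses (eta_gt0 : 0 < eta) (eta_half : eta <= 2^-1) (rho_gt0 : 0 < rho)
  (eta_rho : #|` K0|%:R * eta <= rho / 4) (sigma_gt0 : 0 < sigma).

(** A point leaves the tile along [K0] either by leaving [D c] or by entering the at most
    [eta * #|D|] points of [D c] covered earlier. Each case costs at most [rho / 4 * #|D|], while
    the tile keeps at least half of [D c]. *)
Lemma new_tile_invariant D U c : 1%g \in D ->
  bd R K0 D <= rho / 4 * #|` D|%:R -> added idx D eta U c ->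
  count_in R (new_tile idx D eta U c) (exits K0 (new_tile idx D eta U c)) <=
  rho * #|` new_tile idx D eta U c|%:R.
Proof.
move=> D1 bdD ac; have D0 := card_D_gt0 R D1.
set t := new_tile _ _ _ _ _.
have ht := card_new_tile ac; rewrite -/t in ht.
have gr : count_in R D [set d | greedy idx D eta U (idx c) (d * c)%g] <= eta * #|` D|%:R.
  by move: ac; rewrite /added /sparse => /ltW.
set W := greedy idx D eta U (idx c) in gr.
have : count_in R t (exits K0 t) <= count_in R D (exits K0 D `|`
   [set d | exists2 k, k \in K0 & ((k * d)%g \in D) /\ W (k * (d * c))%g]).
  apply: (sum_comp_le _ (f := fun x => (x * c^-1)%g)).
    by move=> ? ? _ _; exact: mulIg.
  move=> x /mem_new_tile[[d dD ->] nW] [k kK knt]; rewrite mulgK; split=> //.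
  have [kdD|kdD] := boolP ((k * d)%g \in D); last by left; exists k.
  right; exists k => //; split=> //; apply: contrapT => nWk.
  move/negP: knt; apply; apply/mem_new_tile; split=> //.
  by exists (k * d)%g => //; rewrite mulgA.
move=> /le_trans; apply.
apply: (le_trans (count_inU _ _ _ _)).
apply: (@le_trans _ _ (rho / 4 * #|` D|%:R + #|` K0|%:R * eta * #|` D|%:R)).
  apply: lerD => //; apply: (le_trans (count_in_bigcup _ _ _ _)).
  rewrite -mulrA mulr_natl.
  have -> : (eta * #|` D|%:R) *+ #|` K0| = \sum_(k <- K0) eta * #|` D|%:R.
    by rewrite big_const_seq count_predT iter_addr addr0.
  apply: ler_sum => k _; apply: le_trans gr.
  apply: (sum_comp_le _ (f := fun d => (k * d)%g)).
    by move=> ? ? _ _; exact: mulgI.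
  by move=> d dD [kdD Wk]; split=> //; rewrite /= -mulgA.
apply: (@le_trans _ _ (rho * ((1 - eta) * #|` D|%:R))); last by rewrite ler_pM2l.
rewrite -mulrDl mulrA ler_wpM2r//.
have : rho * eta <= rho * 2^-1 by rewrite ler_pM2l.
move: eta_rho; lra.
Qed.

(** The outer [K']-boundary of one [D c] has at most [#|K'| * delta * #|D|] points, and disjointness
    of the new tiles allows at most [2 * #|E| / #|D|] accepted translates inside [E]. *)
Lemma count_enters_tiles D U K' (delta : R) E : 1%g \in D -> 0 <= delta ->
  (forall k, k \in K' ->
     count_in R D [set d | (k^-1 * d)%g \notin D] <= delta * #|` D|%:R) ->
  count_in R E [set x | exists2 c,
    (c \in E) /\ (added idx D eta U c /\ forall d, d \in D -> (d * c)%g \in E) &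
    ((x * c^-1)%g \notin D) /\ exists2 k, k \in K' & (k * (x * c^-1))%g \in D] <=
  2 * #|` K'|%:R * delta * #|` E|%:R.
Proof.
move=> D1 delta0 Hk; have D0 := card_D_gt0 R D1.
pose ok := [set c | added idx D eta U c /\ forall d, d \in D -> (d * c)%g \in E].
pose L := [fset c in E | c \in ok]%fset.
have LP c : c \in L <-> c \in E /\ ok c.
  rewrite !inE; split=> [/andP[? /set_mem]|[? ?]]; first by [].
  by apply/andP; split=> //; exact: mem_set.
pose Q c := [set x | ((x * c^-1)%g \notin D) /\ exists2 k, k \in K' & (k * (x * c^-1))%g \in D].
have -> : count_in R E [set x | exists2 c, (c \in E) /\ ok c & Q c x] =
          count_in R E [set x | exists2 c, c \in L & Q c x].
  by apply: eq_count_in => x _; split=> -[c /LP cL Qc]; exists c => //; apply/LP.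
apply: (le_trans (count_in_bigcup _ _ _ _)).
have hQ c : c \in L -> count_in R E (Q c) <= #|` K'|%:R * (delta * #|` D|%:R).
  move=> _; pose Qk k := [set x | ((x * c^-1)%g \notin D) /\ (k * (x * c^-1))%g \in D].
  have : count_in R E (Q c) <= count_in R E [set x | exists2 k, k \in K' & Qk k x].
    by apply: count_in_le => x _ [h [k ? ?]]; exists k.
  move=> /le_trans; apply; apply: (le_trans (count_in_bigcup _ _ _ _)).
  have -> : #|` K'|%:R * (delta * #|` D|%:R) = \sum_(k <- K') (delta * #|` D|%:R).
    by rewrite big_const_seq count_predT iter_addr addr0 mulr_natl.
  rewrite !big_seq; apply: ler_sum => k kK; apply: le_trans (Hk k kK).
  apply: (sum_comp_le _ (f := fun x => (k * (x * c^-1))%g)).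
    by move=> x y _ _ /mulgI /mulIg.
  by move=> x _ [nD inD]; split=> //=; rewrite mulKg.
have hL : #|` L|%:R * ((1 - eta) * #|` D|%:R) <= #|` E|%:R.
  apply: (@le_trans _ _ (\sum_(c <- L) count_in R E [set` new_tile idx D eta U c])); last first.
    apply: sum_count_in_disj => c c' x /LP[_ [ac _]] /LP[_ [ac' _]] _.
    exact: new_tile_inj.
  have -> : #|` L|%:R * ((1 - eta) * #|` D|%:R) = \sum_(c <- L) ((1 - eta) * #|` D|%:R).
    by rewrite big_const_seq count_predT iter_addr addr0 mulr_natl.
  rewrite !big_seq; apply: ler_sum => c /LP[_ [ac acE]].
  apply: (le_trans (card_new_tile ac)); rewrite -count_inT.
  apply: (sum_comp_le _ (f := id)); first by move=> ? ? ? ?.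
  move=> x xt _; split=> //.

  by case/mem_new_tile: xt => [[d dD ->] _]; exact: acE.
apply: (@le_trans _ _ (#|` L|%:R * (#|` K'|%:R * (delta * #|` D|%:R)))).
  rewrite [leRHS]mulr_natl -iter_addr_0 -(count_predT L) -big_const_seq !big_seq.
  exact: ler_sum.
have h : #|` L|%:R * #|` D|%:R <= 2 * #|` E|%:R :> R.
  have LD0 : 0 <= #|` L|%:R * #|` D|%:R :> R by rewrite mulr_ge0.
  have : #|` L|%:R * #|` D|%:R * eta <= #|` L|%:R * #|` D|%:R * 2^-1 by rewrite ler_wpM2l.
  move: hL; lra.
have : #|` K'|%:R * delta * (#|` L|%:R * #|` D|%:R) <= #|` K'|%:R * delta * (2 * #|` E|%:R).
  by rewrite ler_wpM2l// mulr_ge0.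
lra.
Qed.

(** The finer shape [D] is chosen first, then the previous, coarser generations are taken with outer
    [D]-boundary of density at most [sigma]. The loss does not accumulate, because [(1 - eta) *
    (sigma + (1 - eta) ^+ m) + eta * sigma] equals [sigma + (1 - eta) ^+ m.+1]. *)
Lemma quasi_tiling_step m :
  (forall K' (delta : R), 0 < delta -> exists la U K C,
     quasi_tiling K0 K' rho delta (sigma + (1 - eta) ^+ m) la U K C) ->
  forall K' (delta : R), 0 < delta -> exists la U K C,
     quasi_tiling K0 K' rho delta (sigma + (1 - eta) ^+ m.+1) la U K C.
Proof.
move=> IH K' delta delta0.
(* The first bound serves the invariance of the new tiles, the second makes their outer
   [K']-boundaries cost at most [delta / 2]. *)
pose delta1 := Num.min (rho / 4) (delta / (4 * (#|` K'|%:R + 1))).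
have n1 : 0 < 4 * (#|` K'|%:R + 1) :> R by rewrite mulr_gt0// ltr_wpDl.
have delta1_gt0 : 0 < delta1 by rewrite lt_min !divr_gt0.
have [D D1 bdD] := shape (K0 `|` finv K')%fset delta1_gt0.
have D0 := card_D_gt0 R D1.
have delta2_gt0 : 0 < Num.min (delta / 2) sigma by rewrite lt_min !divr_gt0.
have [la [U [K1 [C [tl C0 out inv bdU cov]]]]] := IH (K' `|` D)%fset _ delta2_gt0.
pose DD := fmul D (finv D).
(* [DD] bounds the new tiles, [fmul DD K'] detects a step of [K'] into a translate of [D] that
   sticks out of [E], and [D] enters through [greedy_cover]. *)
pose K := (K1 `|` DD `|` fmul DD K' `|` D)%fset.
have K1K : (K1 `<=` K)%fset by apply/fsubsetP => x; rewrite !inE => ->.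
have DDK x : x \in DD -> x \in K by rewrite !inE => ->; rewrite !orbT.
have DKK x : x \in fmul DD K' -> x \in K by rewrite !inE => ->; rewrite !orbT.
have DK : (D `<=` K)%fset by apply/fsubsetP => x; rewrite !inE => ->; rewrite !orbT.
have memDD d d' : d \in D -> d' \in D -> (d * d'^-1)%g \in DD.
  by move=> dD d'D; apply: mem_fmul => //; exact: mem_finv.
pose T := new_tile idx D eta U; pose U' := greedy_union idx D eta U.
pose A c := added idx D eta U c.
have UU' : U `<=` U' by exact: (@greedy_sub_union _ _ _ _ _ _ 0).
have : forall y, exists t : {fset G}, [\/ U y /\ t = la y,
   ~ U y /\ (exists2 c, A c & y \in T c /\ t = T c) | ~ U' y /\ t = [fset y]%fset].
  move=> y; have [Uy|nUy] := pselect (U y); first by exists (la y); apply: Or31.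
  have [U'y|nU'y] := pselect (U' y); last by exists [fset y]%fset; apply: Or33.
  have [c Ac yc] := greedy_unionP U'y nUy.
  by exists (T c); apply: Or32; split=> //; exists c.
move=> /choice[la' la'P].
have satU x y : U x -> y \in la x -> U y.
  move=> Ux ylx; apply: contrapT => nUy.
  have := tiling_eq tl ylx; rewrite (out y nUy) => e.
  have := tiling_refl tl x; rewrite -e inE => /eqP xy.
  by apply: nUy; rewrite -xy.
have la'U x : U x -> la' x = la x.
  move=> Ux; case: (la'P x) => [[]//|[]//|[nU' _]]; by case: nU'; exact: UU'.
have la'T c x : A c -> x \in T c -> la' x = T c.
  move=> Ac xc; have nU := new_tile_disj xc.
  case: (la'P x) => [[]//|[_ [c' Ac' [xc' ->]]]|[nU' _]].
    by rewrite (new_tile_inj idx_inj Ac' Ac xc' xc).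
  by case: nU'; exact: new_tile_union xc.
have la'out x : ~ U' x -> la' x = [fset x]%fset.
  move=> nU'; case: (la'P x) => [[/UU']//|[_ [c Ac [xc _]]]|[]//].
  by case: nU'; exact: new_tile_union xc.
exists la', U', K, (2 * C + 2); split; first split.
- move=> x; case: (la'P x) => [[Ux ->]|[_ [c Ac [xc ->]]]|[_ ->]] //.
    exact: tiling_refl tl x.
  by rewrite inE.
- move=> x y; case: (la'P x) => [[Ux ->]|[_ [c Ac [xc ->]]]|[_ lx]].
  + by move=> ylx; rewrite la'U ?(tiling_eq tl ylx)//; exact: satU ylx.
  + exact: la'T.
  + by rewrite lx inE => /eqP ->.
- move=> x y; case: (la'P x) => [[Ux ->]|[_ [c Ac [xc ->]]]|[_ ->]].
  + by move=> /(tiling_bounded tl); exact: (fsubsetP K1K).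
  + move: xc => /mem_new_tile[[d dD ->] _] /mem_new_tile[[d' d'D ->] _].
    by apply: DDK; rewrite invgM mulgA mulgK memDD.
  + by rewrite inE => /eqP ->; rewrite mulgV; apply: DDK; rewrite -(mulgV 1%g) memDD.
- by rewrite addr_ge0// mulr_ge0.
- exact: la'out.
- move=> x U'x; case: (la'P x) => [[Ux ->]|[_ [c Ac [xc ->]]]|[]//].
    exact: inv.
  apply: new_tile_invariant => //.
  apply: le_trans (le_trans (bd_sub _ _ _) bdD) _ ; first exact: fsubsetUl.
  by rewrite ler_pM2r// ge_min lexx.
- move=> E.
  pose S := [set x | exists2 c,
    (c \in E) /\ (added idx D eta U c /\ forall d, d \in D -> (d * c)%g \in E) &
    ((x * c^-1)%g \notin D) /\ exists2 k, k \in K' & (k * (x * c^-1))%g \in D].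
  (* A step of [K'] into the new union reaches an old tile, or a translate [D c] inside [E] (counted
     by [S]), or a translate [D c] sticking out of [E]; in the last case [d' * d^-1 * k] leads from
     [x] out of [E]. *)
  have : count_in R E (enters K' U') <=
         count_in R E (enters (K' `|` D)%fset U `|` (exits K E `|` S)).
    apply: count_in_le => x xE [nU' [k kK U'k]].
    have [Uk|nUk] := pselect (U (k * x)%g).
      by left; split; [move=> /UU'|exists k => //; rewrite inE kK].
    right; have [c Ac /mem_new_tile[[d dD kx] _]] := greedy_unionP U'k nUk.
    have [cE|ncE] := pselect (forall d, d \in D -> (d * c)%g \in E).
      right; exists c; first by split=> //; rewrite -[c]mul1g cE.
      split; last by exists k => //; rewrite mulgA kx mulgK.
      apply/negP => xD; apply: nU'; rewrite -(mulgVK c x).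
      exact: (added_sub_union Ac xD).
    left; move/existsNP: ncE => [d' /not_implyP[d'D /negP d'c]].
    exists (d' * d^-1 * k)%g; first by apply: DKK; apply: mem_fmul => //; exact: memDD.
    by rewrite -2!mulgA kx mulKg.
  move=> /le_trans; apply.
  apply: (le_trans (count_inU _ _ _ _)).
  have hS : count_in R E S <= 2 * #|` K'|%:R * delta1 * #|` E|%:R.
    apply: count_enters_tiles => //; first exact: ltW.
    move=> k kK; apply: le_trans bdD; apply: count_in_le => d dD kd.
    by exists (k^-1)%g => //; rewrite inE mem_finv// orbT.
  have hS2 : 2 * #|` K'|%:R * delta1 <= delta / 2.
    apply: (@le_trans _ _ (2 * (#|` K'|%:R + 1) * (delta / (4 * (#|` K'|%:R + 1))))).
      apply: ler_pM; [by rewrite mulr_ge0|exact: ltW| |].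
        by rewrite ler_pM2l// lerDl.
      by rewrite /delta1 ge_min lexx orbT.
    rewrite le_eqVlt; apply/orP; left; apply/eqP; field.
    by rewrite gt_eqF// ltr_wpDl.
  have h1 := count_inU R E (exits K E) S.
  have h2 := bdU E.
  have h3 : Num.min (delta / 2) sigma * #|` E|%:R <= delta / 2 * #|` E|%:R.
    by rewrite ler_wpM2r// ge_min lexx.
  have h4 : 2 * #|` K'|%:R * delta1 * #|` E|%:R <= delta / 2 * #|` E|%:R.
    by rewrite ler_wpM2r.
  have h5 : C * bd R K1 E <= C * bd R K E by rewrite ler_wpM2l// bd_sub.
  have h6 : 0 <= C * bd R K E by rewrite mulr_ge0// bd_ge0.
  have h7 := bd_ge0 R K E; rewrite -/(bd R K E) in h1.
  lra.
- move=> E; apply: (le_trans (greedy_cover _ _ _ _ _ _)) => //.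
  have h1 := cov E; have h2 := bdU E.
  have h3 : Num.min (delta / 2) sigma * #|` E|%:R <= sigma * #|` E|%:R.
    by rewrite ler_wpM2r// ge_min lexx orbT.
  have h5 : C * bd R K1 E <= C * bd R K E by rewrite ler_wpM2l// bd_sub.
  have h6 : 0 <= C * bd R K E by rewrite mulr_ge0// bd_ge0.
  have h7 := bd_ge0 R K E.
  have h8 : bd R D E <= bd R K E by rewrite bd_sub.
  have h9 : count_in R E (enters D U) <= sigma * #|` E|%:R + C * bd R K E.
    apply: (@le_trans _ _ (count_in R E (enters (K' `|` D)%fset U))); last lra.
    by apply: count_in_le => x _ [nU [k kD Uk]]; split=> //; exists k => //; rewrite inE kD orbT.
  have e1 : 0 <= 1 - eta by move: eta_half; lra.
  have h10 : (1 - eta) * count_in R E (~` U) <=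
    (1 - eta) * ((sigma + (1 - eta) ^+ m) * #|` E|%:R + C * bd R K E).
    by rewrite ler_wpM2l//; lra.
  have h11 : eta * bd R D E <= 2^-1 * bd R K E.
    by apply: ler_pM => //; [exact: ltW|exact: bd_ge0].
  have h12 : eta * count_in R E (enters D U) <= eta * (sigma * #|` E|%:R + C * bd R K E).
    by rewrite ler_pM2l.
  rewrite exprS; move: h10 h11 h12; lra.
Qed.

Lemma quasi_tiling_exists m K' (delta : R) : 0 < delta -> exists la U K C,
  quasi_tiling K0 K' rho delta (sigma + (1 - eta) ^+ m) la U K C.
Proof.
elim: m K' delta => [|m IH]; last exact: quasi_tiling_step.
move=> K' delta delta0; exists (fun x => [fset x]%fset), set0, [fset 1%g]%fset, 0.
split=> //; first split.
- by move=> x; rewrite inE.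
- by move=> x y; rewrite inE => /eqP ->.
- by move=> x y; rewrite inE => /eqP ->; rewrite mulgV inE.
- move=> E; rewrite mul0r addr0 /count_in big1 => [|x _].
    by rewrite mulr_ge0// ltW.
  by case: (boolP (x \in _)) => // /set_mem[_ [k _ []]].
- move=> E; rewrite mul0r addr0 expr0 (le_trans (count_in_leT _ _ _))//.
  by rewrite mulrDl mul1r lerDr mulr_ge0// ltW.
Qed.

End QuasiTilings.

Section InvariantTiling.
Variables (R : realType) (G : groupType).
Variables (idx : G -> nat) (idx_inj : injective idx).
Hypothesis shape : forall K (delta : R), 0 < delta ->
  exists2 D : {fset G}, 1%g \in D & bd R K D <= delta * #|` D|%:R.

Lemma expr_lt_ex (x e : R) : 0 <= x < 1 -> 0 < e -> exists m, x ^+ m < e.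
Proof.
move=> /andP[x0 x1] e0.
have := @cvg_expr R x; rewrite ger0_norm// => /(_ x1) /cvgrPdist_lt /(_ _ e0).
move=> /filter_ex[m]; rewrite sub0r normrN ger0_norm ?exprn_ge0// => ?; by exists m.
Qed.

Lemma leaves_tile la K E x y : tiling la K -> x \in E ->
  y \in la x -> y \notin E -> @exits G K E x.
Proof.
move=> tl xE ylx nyE; exists (y * x^-1)%g; first exact: tiling_bounded ylx.
by rewrite mulgVK.
Qed.

(** The bad points of [E] are the uncovered ones, of density at most [2 * rho], those whose tile
    sticks out of [E], which are boundary points, and those in tiles inside [E], of density at most
    [rho] by invariance of each tile. *)
Lemma invariant_tiling K0 (eps : R) : 0 < eps ->
  exists (la : G -> {fset G}) (K : {fset G}) (C : R), [/\ tiling la K, 0 <= C & forall E,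
    count_in R E [set x | exits K0 (la x) x] <= eps * #|` E|%:R + C * bd R K E].
Proof.
move=> eps0; pose rho := eps / 4; have rho0 : 0 < rho by rewrite divr_gt0.
have n1 : 0 < 4 * (#|` K0|%:R + 1) :> R by rewrite mulr_gt0// ltr_wpDl.
pose eta : R := Num.min 2^-1 (rho / (4 * (#|` K0|%:R + 1))).
have eta0 : 0 < eta by rewrite lt_min invr_gt0 ltr0n divr_gt0.
have eta_half : eta <= 2^-1 by rewrite ge_min lexx.
have eta_rho : #|` K0|%:R * eta <= rho / 4.
  apply: (@le_trans _ _ ((#|` K0|%:R + 1) * (rho / (4 * (#|` K0|%:R + 1))))).
    apply: ler_pM; [by []|exact: ltW|by rewrite lerDl|].
    by rewrite /eta ge_min lexx orbT.
  rewrite le_eqVlt; apply/orP; left; apply/eqP; field.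
  by rewrite gt_eqF// ltr_wpDl.
have [m hm] : exists m, (1 - eta) ^+ m < rho.
  by apply: expr_lt_ex => //; apply/andP; split; lra.
(* Here [sigma] and [delta] both equal [rho]; the bound on the outer boundary only served the
   induction. *)
have [la [U [K [C [tl C0 out inv _ cov]]]]] :=
  quasi_tiling_exists idx_inj shape eta0 eta_half rho0 eta_rho rho0 m K0 rho0.
exists la, K, (C + 1); split => // [|E]; first by rewrite addr_ge0.
pose good := [set x | U x /\ (la x `<=` E)%fset].
pose E' := [fset x in E | x \in good]%fset.
have E'P x : x \in E' <-> x \in E /\ good x.
  rewrite !inE; split=> [/andP[? /set_mem]|[? ?]]; first by [].
  by apply/andP; split=> //; exact: mem_set.
have satU x y : U x -> y \in la x -> U y.
  move=> Ux ylx; apply: contrapT => nUy.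
  have := tiling_eq tl ylx; rewrite (out y nUy) => e.
  have := tiling_refl tl x; rewrite -e inE => /eqP xy.
  by apply: nUy; rewrite -xy.
pose bad := [set x | exits K0 (la x) x].
have h1 : count_in R E bad <= count_in R E (~` U `|` (exits K E `|` [set x | bad x /\ x \in E'])).
  apply: count_in_le => x xE bx.
  have [Ux|nUx] := pselect (U x); last by left.
  right; have [sub|] := boolP (la x `<=` E)%fset.
    by right; split=> //; apply/E'P.
  by move=> /fsubsetPn[y ylx nyE]; left; exact: leaves_tile ylx nyE.
have h2 : count_in R E [set x | bad x /\ x \in E'] <= rho * #|` E|%:R.
  apply: (@le_trans _ _ (count_in R E' bad)).
    apply: (sum_comp_le _ (f := id)); first by move=> ? ? ? ?.
    by move=> x xE [].
  apply: (@le_trans _ _ (\sum_(x <- E') rho)); last first.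
    rewrite big_const_seq count_predT iter_addr addr0 -[leLHS]mulr_natr ler_pM2l//.
    by rewrite ler_nat fsubset_leq_card//; apply/fsubsetP => x /E'P[].
  rewrite -[leLHS]ger0_norm ?count_in_ge0//; apply: (tile_sum tl).
    move=> x /E'P[xE [Ux /fsubsetP sub]]; apply/fsubsetP => y ylx; apply/E'P.
    split; first exact: sub.
    by split; [exact: satU ylx|rewrite (tiling_eq tl ylx); apply/fsubsetP].
  move=> x /E'P[xE [Ux _]]; rewrite ger0_norm ?count_in_ge0//.
  rewrite big_const_seq count_predT iter_addr addr0 -[leRHS]mulr_natr.
  apply: le_trans (inv x Ux); apply: count_in_le => y ylx.
  by rewrite /bad /= (tiling_eq tl ylx).
have h3 := count_inU R E (~` U) (exits K E `|` [set x | bad x /\ x \in E']).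
have h4 := count_inU R E (exits K E) [set x | bad x /\ x \in E'].
have h5 := cov E; have h6 := bd_ge0 R K E; rewrite -/(bd R K E) in h4.
have h7 : (1 - eta) ^+ m * #|` E|%:R <= rho * #|` E|%:R by rewrite ler_wpM2r// ltW.
have h8 : 0 <= rho * #|` E|%:R by rewrite mulr_ge0// ltW.
rewrite -/bad; rewrite /rho in h2 h5 h7 h8; lra.
Qed.

End InvariantTiling.

(** * Balanced choice of orbit patterns *)

Section Averaging.
Variables (R : realType) (d : measure_display) (X : measurableType d).
Variable mu : probability X R.

Lemma integral_sum_indic (J : Type) (s : seq J) (a : J -> R) (M : J -> set X) :
  (forall j, measurable (M j)) ->
  mu.-integrable setT (fun x => (\sum_(j <- s) a j * \1_(M j) x)%:E) /\
  (\int[mu]_x (\sum_(j <- s) a j * \1_(M j) x)%:E =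
    (\sum_(j <- s) a j * fine (mu (M j)))%:E)%E.
Proof.
move=> mM; elim: s => [|j s [IH1 IH2]].
  split; last by under eq_integral do rewrite big_nil; rewrite integral0 big_nil.
  by under eq_fun do rewrite big_nil; exact: integrable0.
have i1 : mu.-integrable setT (fun x => (a j)%:E * (\1_(M j) x)%:E)%E.
  by apply: integrableZl => //; exact: integrable_indic.
split.
  under eq_fun do rewrite big_cons EFinD EFinM.
  exact: integrableD.
under eq_integral do rewrite big_cons EFinD EFinM.
rewrite integralD// IH2 big_cons EFinD; congr (_ + _)%E.
rewrite integralZl//; last exact: integrable_indic.
rewrite integral_indic// setIT EFinM fineK//; exact: fin_num_measure.
Qed.

(** Otherwise the function minus its mean is strictly positive everywhere with integral zero, hence
    zero almost everywhere, so the whole space would be null. *)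
Lemma exists_le_mean (J : Type) (s : seq J) (a : J -> R) (M : J -> set X) :
  (forall j, measurable (M j)) ->
  exists x, \sum_(j <- s) a j * \1_(M j) x <= \sum_(j <- s) a j * fine (mu (M j)).
Proof.
move=> mM; apply: contrapT => /forallNP nle.
set c := \sum_(j <- s) _ * fine _ in nle.
pose f x := \sum_(j <- s) a j * \1_(M j) x.
have [i1 i2] := integral_sum_indic s a mM; rewrite -/c in i2.
have fc x : 0 < f x - c by rewrite subr_gt0 ltNge; apply/negP; exact: nle.
have ic : mu.-integrable setT (EFin \o cst c) by exact: finite_measure_integrable_cst.
have ifc : mu.-integrable setT (EFin \o (fun x => f x - c)).
  by rewrite /comp; under eq_fun do rewrite EFinB; exact: integrableB.
have : (\int[mu]_x `|(EFin \o (fun x => f x - c)%R) x| = 0)%E.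
  under eq_integral => x _ do rewrite /= ger0_norm ?ltW// EFinB.
  rewrite integralB//= i2 integral_cst//.
  transitivity (c%:E - c%:E * 1)%E; last by rewrite mule1 subee.
  by congr (_ - _ * _)%E; exact: probability_setT.
move=> /(ae_eq_integral_abs mu measurableT (measurable_int mu ifc)) [N [mN N0 sub]].
have : mu setT = 0%E.
  apply/eqP; rewrite -measure_le0 -[leRHS]N0 le_measure ?inE// => x _; apply: sub => /=.
  by move=> /(_ Logic.I) [fc0]; have := fc x; rewrite fc0 ltxx.
by rewrite probability_setT => /eqP; rewrite onee_eq0.
Qed.

End Averaging.

Section SignChoice.
Variable R : realType.

(* Choosing the t-th term with nonpositive inner product against the partial
   sum makes squared norms add up, as for orthogonal vectors. *)
Lemma balanced_choice (X : Type) (J : choiceType) (n : nat) (ts : seq J) (q : R)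
    (v : J -> X -> 'I_n -> R) : X ->
  (forall t x, \sum_i v t x i ^+ 2 <= q) ->
  (forall t (V : 'I_n -> R), exists x, \sum_i V i * v t x i <= 0) -> uniq ts ->
  exists chi : J -> X,
    \sum_i (\sum_(t <- ts) v t (chi t) i) ^+ 2 <= q * (size ts)%:R.
Proof.
move=> x0 vq vneg; elim: ts => [_|t ts IH /= /andP[tts uts]].
  exists (fun=> x0); rewrite mulr0 big1// => i _.
  by rewrite big_nil expr0n.
have [chi hchi] := IH uts.
pose V i := \sum_(t <- ts) v t (chi t) i.
have [x hx] := vneg t V.
exists (fun t' => if t' == t then x else chi t').
rewrite (eq_bigr (fun i => v t x i ^+ 2 + 2 * (V i * v t x i) + V i ^+ 2)); last first.
  move=> i _; rewrite big_cons eqxx.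
  have -> : \sum_(j <- ts) v j (if j == t then x else chi j) i = V i.
    rewrite /V !big_seq; apply: eq_bigr => j jts; case: eqP => // jt.
    by rewrite -jt jts in tts.
  ring.
rewrite !big_split /= -mulr_sumr -[(size ts).+1%:R]natr1 mulrDr mulr1.
have := vq t x; rewrite -/V in hchi; move: hx hchi; rewrite /V; lra.
Qed.

End SignChoice.

(** * Deviations of pattern frequencies *)

Section Deviation.
Variables (R : realType) (G : groupType).
Variables (H : nat -> {fset G}) (mean : nat -> R).
Hypothesis mean01 : forall i, 0 <= mean i <= 1.
Implicit Types (E K S : {fset G}) (A : set G).

(* The intersection of the translates hA, h in Hs. *)
Definition hits A (Hs : {fset G}) : set G :=
  [set g | forall h, h \in Hs -> A (h^-1 * g)%g].

Definition dev A i E : R := \sum_(g <- E) ((g \in hits A (H i))%:R - mean i).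

(** The window of the first [n] statistics: at [g] they read [A] only at the points [h^-1 * g]. *)
Definition inverses n : {fset G} := (\bigcup_(i <- iota 0 n) finv (H i))%fset.

Lemma mem_inverses n i h : (i < n)%N -> h \in H i -> (h^-1)%g \in inverses n.
Proof.
move=> i_n hH; apply/bigfcupP; exists i; last exact: mem_finv.
by rewrite andbT mem_iota.
Qed.

Lemma indic_sub_mean_le1 (b : bool) i : `|b%:R - mean i| <= 1.
Proof.
by case/andP: (mean01 i) => ? ?; rewrite ler_norml; case: b => /=; apply/andP; split; lra.
Qed.

(** At a point whose window carries a single label, the glued set and the set of that label agree.
    The labels are tiles, or later the two sides of a seam. *)
Lemma dev_glue (L : Type) (lab : G -> L) (Af : L -> set G) i E :
  `|dev [set g | Af (lab g) g] i E -
    \sum_(g <- E) ((g \in hits (Af (lab g)) (H i))%:R - mean i)| <=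
  count_in R E [set g | exists2 h, h \in H i & lab (h^-1 * g)%g <> lab g].
Proof.
rewrite /dev -sumrB (le_trans (ler_norm_sum _ _ _))//; apply: ler_sum => g _.
case: (boolP (g \in [set g | exists2 h, _ & _])) => [_|nl].
  by case: (g \in _); case: (g \in _) => /=; rewrite ler_norml; apply/andP; split; lra.
have same h : h \in H i -> lab (h^-1 * g)%g = lab g.
  by move=> hH; apply: contrapT => ne; move/negP: nl; apply; apply/mem_set; exists h.
have -> : (g \in hits [set g | Af (lab g) g] (H i)) = (g \in hits (Af (lab g)) (H i)).
  by apply/idP/idP => /set_mem hg; apply/mem_set => h hH;
     have := hg h hH; rewrite /= same.
by rewrite subrr normr0.
Qed.

End Deviation.

Section Patterns.
Variables (R : realType) (G : groupType).
Variables (idx : G -> nat) (idx_inj : injective idx).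
Hypothesis shape : forall K (delta : R), 0 < delta ->
  exists2 D : {fset G}, 1%g \in D & bd R K D <= delta * #|` D|%:R.
Variables (d : measure_display) (X : measurableType d) (mu : probability X R).
Variables (T : G -> X -> X) (T_mp : measure_preserving_action mu T).
Variables (B : set X) (B_measurable : measurable B).
Variable H : nat -> {fset G}.

(* The intersection of the T_h B, h in Hs. *)
Definition cylinder (Hs : {fset G}) : set X :=
  [set y | forall h, h \in Hs -> B (T (h^-1)%g y)].

Definition cylinder_mean i : R := fine (mu (cylinder (H i))).

Lemma measurable_preimage g C : measurable C -> measurable (T g @^-1` C).
Proof. by move=> mC; rewrite -[X in measurable X]setTI; exact: (mp_measurable T_mp). Qed.

Lemma measurable_cylinder Hs : measurable (cylinder Hs).
Proof.
have -> : cylinder Hs = \bigcap_(h in [set` Hs]) (T (h^-1)%g @^-1` B) by [].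
by apply: fin_bigcap_measurable => // h _; exact: measurable_preimage.
Qed.

Lemma cylinder_mean01 i : 0 <= cylinder_mean i <= 1.
Proof.
have mC := measurable_cylinder (H i).
apply/andP; split; first exact: fine_ge0.
by rewrite -lee_fin fineK ?fin_num_measure//; exact: probability_le1.
Qed.

Local Notation devi := (dev H cylinder_mean).

Lemma hits_orbit x g i :
  (g \in hits [set g' | B (T g' x)] (H i)) = (T g x \in cylinder (H i)).
Proof.
by apply/idP/idP => /set_mem hg; apply/mem_set => h hH; have := hg h hH;
   rewrite /= (mp_actionM T_mp).
Qed.

(** Since [q * s] is the product of [e * s] and [q / e], it is at most the square of their sum. This
    turns a square-root bound into a small linear term plus a constant. *)
Lemma sqr_le_bound (a q s e : R) : 0 < e -> 0 <= s -> 0 <= q ->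
  a ^+ 2 <= q * s -> `|a| <= e * s + q / e.
Proof.
move=> e0 s0 q0 aqs; have h0 : 0 <= e * s by rewrite mulr_ge0// ltW.
have h1 : 0 <= q / e by rewrite divr_ge0// ltW.
rewrite -(@ler_pXn2r _ 2) ?nnegrE ?addr_ge0//.
rewrite -normrX ger0_norm ?sqr_ge0// (le_trans aqs)//.
have e2 : (e * s) * (q / e) = q * s by field; rewrite gt_eqF.
rewrite sqrrD e2 -mulr_natr; have := sqr_ge0 (e * s); have := sqr_ge0 (q / e).
have : 0 <= q * s by rewrite mulr_ge0.
lra.
Qed.

Lemma card_tile_le la K (S t : {fset G}) : tiling la K ->
  count_in R S [set g | la g = t] <= #|` K|%:R.
Proof.
move=> tl; have [[g0 g0t]|nt] := pselect (exists g0, la g0 = t); last first.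
  rewrite /count_in big1 ?ler0n// => g _.
  by case: (boolP (g \in _)) => // /set_mem gt; case: nt; exists g.
rewrite -[leRHS](count_inT R).
apply: (sum_comp_le _ (f := fun g => (g * g0^-1)%g)); first by move=> ? ? _ _; exact: mulIg.
move=> g _ /= gt; split=> //; apply: (tiling_bounded tl).
by rewrite g0t -gt; exact: tiling_refl tl g.
Qed.

(** Each tile carries the orbit pattern of a point of [X], all points being chosen by
    [balanced_choice]. The tiles meeting [S] number at most [#|S|], and points whose window crosses
    tiles are few by [invariant_tiling]. [K] and [C] are fixed before [S]. *)
Lemma pattern_exists n (eps : R) : 0 < eps -> exists (K : {fset G}) (C : R),
  0 <= C /\ forall S, exists A : set G, forall i, (i < n)%N ->
    `|devi A i S| <= eps * #|` S|%:R + C * (1 + bd R K S).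
Proof.
move=> eps0; pose e := eps / 2; have e0 : 0 < e by rewrite divr_gt0.
have [la [K [C1 [tl C10 inv]]]] := invariant_tiling idx_inj shape (inverses H n) e0.
(* Bounds the squared norm of the deviation of one tile: [n] coordinates, each at most the tile
   size. *)
pose q : R := n%:R * #|` K|%:R ^+ 2.
have q0 : 0 <= q by rewrite mulr_ge0// sqr_ge0.
(* Applied to the empty sum, this only provides a point of [X]. *)
have [x0 _] := @exists_le_mean _ _ _ mu nat [::] (fun=> 0) (fun=> setT) (fun=> measurableT).
exists K, (C1 + q / e); split=> [|S]; first by rewrite addr_ge0// divr_ge0// ltW.
pose v (t : {fset G}) (x : X) (i : 'I_n) : R :=
  \sum_(g <- S | la g == t) ((T g x \in cylinder (H i))%:R - cylinder_mean i).
have vbound t x i : `|v t x i| <= #|` K|%:R.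
  apply: le_trans (card_tile_le S t tl).
  rewrite /v /count_in (le_trans (ler_norm_sum _ _ _))//= big_mkcond /=.
  apply: ler_sum => g _; case: eqP => [gt|//].
  by rewrite [g \in _]mem_set//; exact: (indic_sub_mean_le1 cylinder_mean01).
have vq t x : \sum_i v t x i ^+ 2 <= q.
  have -> : q = \sum_(i < n) #|` K|%:R ^+ 2.
    by rewrite sumr_const card_ord /q mulr_natl.
  apply: ler_sum => i _; rewrite -[v t x i ^+ 2]ger0_norm ?sqr_ge0// normrX.
  by rewrite ler_pXn2r// ?nnegrE.
(* As [mu] is invariant under each [T g], the inner product has mean zero over [x], so some [x]
   makes it nonpositive. *)
have vneg t (V : 'I_n -> R) : exists x, \sum_i V i * v t x i <= 0.
  pose s := [seq (g, i) | g <- [seq g <- S | la g == t], i <- index_enum 'I_n].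
  have mM (j : G * 'I_n) : measurable (T j.1 @^-1` cylinder (H j.2)).
    exact/measurable_preimage/measurable_cylinder.
  have [x hx] := exists_le_mean mu s (fun j => V j.2) mM; exists x.
  move: hx; rewrite !big_allpairs /= -subr_le0 -sumrB !big_filter.
  rewrite (_ : \sum_(i <- S | _) _ = \sum_i V i * v t x i)//.
  under [RHS]eq_bigr do rewrite mulr_sumr.
  rewrite [RHS]exchange_big /=; apply: eq_bigr => g _.
  rewrite -sumrB; apply: eq_bigr => i _.
  rewrite mulrBr (mp_preserving T_mp)//; exact: measurable_cylinder.
have [chi hchi] := balanced_choice x0 vq vneg (fset_uniq (la @` S)%fset).
exists [set g | [set g' | B (T g' (chi (la g)))] g] => i i_n.
have h1 := dev_glue H cylinder_mean la (fun t => [set g' | B (T g' (chi t))]) i S.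
have e1 : \sum_(g <- S) ((g \in hits [set g' | B (T g' (chi (la g)))] (H i))%:R - cylinder_mean i)
    = \sum_(t <- (la @` S)%fset) v t (chi t) (Ordinal i_n).
  rewrite (partition_big_imfset _ la) /=; apply: eq_bigr => t _.
  by apply: eq_bigr => g /eqP gt; rewrite hits_orbit gt.
have h2 : `|\sum_(t <- (la @` S)%fset) v t (chi t) (Ordinal i_n)| <= e * #|` S|%:R + q / e.
  apply: sqr_le_bound => //.
  apply: (@le_trans _ _ (q * #|` (la @` S)%fset|%:R)).
    apply: le_trans hchi; rewrite (bigD1 (Ordinal i_n))//= lerDl.
    by apply: sumr_ge0 => j _; exact: sqr_ge0.
  by rewrite ler_wpM2l// ler_nat leq_imfset_card.
have h3 : count_in R S [set g | exists2 h, h \in H i & la (h^-1 * g)%g <> la g] <=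
    e * #|` S|%:R + C1 * bd R K S.
  apply: le_trans (inv S); apply: count_in_le => g _ [h hH ne].
  exists (h^-1)%g; first exact: mem_inverses hH.
  by apply/negP => /(tiling_eq tl).
rewrite e1 in h1.
have h5 : 0 <= q / e * bd R K S by rewrite mulr_ge0 ?bd_ge0// divr_ge0// ltW.
set a := devi _ _ _; set b := \sum_(t <- _) _ in h1 h2.
have h6 : `|a| <= `|a - b| + `|b| by rewrite -{1}(subrK b a) ler_normD.
have h7 : `|a - b| <= e * #|` S|%:R + C1 * bd R K S by apply: le_trans h1 h3.
rewrite (_ : eps = e + e); last by rewrite /e; field.
lra.
Qed.

End Patterns.

(** * Approximate sets and their gluing *)

Section Approximation.
Variables (R : realType) (G : groupType).
Variables (idx : G -> nat) (idx_inj : injective idx).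
Hypothesis shape : forall K (delta : R), 0 < delta ->
  exists2 D : {fset G}, 1%g \in D & bd R K D <= delta * #|` D|%:R.
Hypothesis large : forall n, exists K : {fset G}, (n <= #|` K|)%N.
Variables (H : nat -> {fset G}) (mean : nat -> R).
Hypothesis mean01 : forall i, 0 <= mean i <= 1.
Implicit Types (E K S : {fset G}) (A : set G) (C eps : R).

Local Notation devi := (dev H mean).

Hypothesis pattern : forall n eps, 0 < eps -> exists (K : {fset G}) (C : R),
  0 <= C /\ forall S, exists A : set G, forall i, (i < n)%N ->
    `|devi A i S| <= eps * #|` S|%:R + C * (1 + bd R K S).

(** Uniform in [E]: for a Folner sequence, a threshold on [N] then depends only on [n], [eps], [K]
    and [C]. *)
Definition good n eps A K C := 0 <= C /\ forall E i, (i < n)%N ->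
  `|devi A i E| <= eps * #|` E|%:R + C * (1 + bd R K E).

Lemma not_exits_card K (t : {fset G}) g : ~ exits K t g -> (#|` K| <= #|` t|)%N.
Proof.
move=> nex; have <- : #|` [fset (k * g)%g | k in K]%fset| = #|` K|.
  by rewrite card_imfset //=; exact: mulIg.
apply: fsubset_leq_card; apply/fsubsetP => y /imfsetP[k /= kK ->].
by apply/negPn/negP => kg; apply: nex; exists k.
Qed.

(** Each tile of a second tiling receives its own set from [pattern]. The additive constant per tile
    is harmless because the tiles are large, and the boundary terms because they are invariant. *)
Lemma good_exists n eps : 0 < eps -> exists A K C, good n eps A K C.
Proof.
move=> eps0; have e4 : 0 < eps / 4 by rewrite divr_gt0.
have [K2 [C2 [C20 /choice[pat patP]]]] := pattern n e4.
(* A tile with at least [N0] points absorbs the constant [C2] at cost [eps / 4] per point. *)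
pose N0 := (Num.truncn (C2 / (eps / 4))).+1.
have N0P : C2 / (eps / 4) <= N0%:R by rewrite ltW// truncnS_gt.
have [Big BigP] := large N0.
(* [K2] controls the boundary term of each tile, [inverses H n] the gluing, and [Big] forces the
   tile of any point that is not bad to be large. *)
pose K0 := (K2 `|` inverses H n `|` Big)%fset.
(* Total weight of a bad point: [2 * C2] from [w] and [1] from the gluing. *)
pose C3 := 2 * C2 + 1; have C30 : 0 < C3 by rewrite /C3; lra.
have e1 : 0 < eps / 2 / C3 by rewrite !divr_gt0.
have [la [K3 [C4 [tl C40 inv]]]] := invariant_tiling idx_inj shape K0 e1.
exists [set g | pat (la g) g], K3, (C3 * C4 + 1); split=> [|E i i_n].
  by rewrite addr_ge0// mulr_ge0// ltW.
pose bad := [set x | exits K0 (la x) x].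
pose f g : R := (g \in hits (pat (la g)) (H i))%:R - mean i.
have K2K : (K2 `<=` K0)%fset by apply/fsubsetP => x; rewrite !inE => ->.
have BK : (Big `<=` K0)%fset by apply/fsubsetP => x; rewrite !inE => ->; rewrite !orbT.
have h1 : `|devi [set g | pat (la g) g] i E - \sum_(g <- E) f g| <= count_in R E bad.
  apply: le_trans (dev_glue H mean la pat i E) _.
  apply: count_in_le => g _ [h hH ne]; exists (h^-1)%g.
    by rewrite !inE (mem_inverses i_n hH) orbT.
  by apply/negP => /(tiling_eq tl).
pose inside := [set g | (la g `<=` E)%fset].
pose E' := [fset g in E | g \in inside]%fset.
have E'P x : x \in E' <-> x \in E /\ (la x `<=` E)%fset.
  rewrite !inE; split=> [/andP[? /set_mem]|[? ?]]; first by [].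
  by apply/andP; split=> //; exact: mem_set.
have h2 : `|\sum_(g <- E) f g - \sum_(g <- E') f g| <= bd R K3 E.
  rewrite (big_fsetID _ [pred g | g \in inside]) /= addrAC subrr add0r.
  rewrite (le_trans (ler_norm_sum _ _ _))//= big_fset /= big_mkcond /=.
  rewrite /bd /count_in !big_seq; apply: ler_sum => g gE.
  case: (boolP (g \in inside)) => [_//|gout] /=.
  rewrite [g \in exits _ _]mem_set; first exact: indic_sub_mean_le1.
  have [|/fsubsetPn[y ylx nyE]] := boolP (la g `<=` E)%fset.
    by move=> gin; move/negP: gout; case; exact: mem_set.
  exact: leaves_tile ylx nyE.
(* The error that [pattern] allows on a tile, spread over the points of the tile. *)
pose w g : R := eps / 4 + C2 / #|` la g|%:R + C2 * (g \in [set g | exits K2 (la g) g])%:R.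
have h3 : `|\sum_(g <- E') f g| <= \sum_(g <- E') w g.
  apply: (tile_sum tl) => x /E'P[xE /fsubsetP sub].
    apply/fsubsetP => y ylx; apply/E'P; split; first exact: sub.
    by rewrite (tiling_eq tl ylx); apply/fsubsetP.
  have la0 : #|` la x|%:R != 0 :> R.
    rewrite pnatr_eq0 -lt0n cardfs_gt0; apply/fset0Pn; exists x.
    exact: tiling_refl tl x.
  have -> : \sum_(y <- la x) f y = devi (pat (la x)) i (la x).
    by rewrite /dev !big_seq; apply: eq_bigr => y ylx; rewrite /f (tiling_eq tl ylx).
  apply: (le_trans (patP (la x) i i_n)).
  have -> : \sum_(y <- la x) w y =
     \sum_(y <- la x) (eps / 4 + C2 / #|` la x|%:R + C2 * (y \in exits K2 (la x))%:R).
    rewrite !big_seq; apply: eq_bigr => y ylx; rewrite /w (tiling_eq tl ylx).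
    congr (_ + _ * (nat_of_bool _)%:R).
    by apply/idP/idP => /set_mem; rewrite /= ?(tiling_eq tl ylx) => ?; apply/mem_set => //=;
       rewrite (tiling_eq tl ylx).
  have const_sum (c : R) : \sum_(y <- la x) c = c * #|` la x|%:R.
    by rewrite big_const_seq count_predT iter_addr addr0 mulr_natr.
  rewrite !big_split /= -[X in _ <= _ + X]mulr_sumr !const_sum.
  rewrite -/(count_in R _ _) -/(bd R K2 (la x)).
  by rewrite divfK// mulrDr mulr1 addrA.
have h4 : \sum_(g <- E') w g <= eps / 2 * #|` E|%:R + 2 * C2 * count_in R E bad.
  apply: (@le_trans _ _ (\sum_(g <- E') (eps / 2 + 2 * C2 * (g \in bad)%:R))).
    apply: ler_sum => g _; rewrite /w.
    have m1 : C2 * (g \in [set g | exits K2 (la g) g])%:R <= C2 * (g \in bad)%:R.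
      rewrite ler_wpM2l//; apply: mem_natr_le => -[k kK kg]; exists k => //.
      exact: (fsubsetP K2K).
    have [gb|ngb] := pselect (bad g).
      rewrite [g \in bad]mem_set//= in m1 *.
      have : C2 / #|` la g|%:R <= C2.
        rewrite ler_piMr// invf_le1 ?ltr0n ?ler1n ?cardfs_gt0;
          by apply/fset0Pn; exists g; exact: tiling_refl tl g.
      lra.
    have : C2 / #|` la g|%:R <= eps / 4.
      have N1 : N0%:R <= #|` la g|%:R :> R.
        rewrite ler_nat (leq_trans BigP)//; apply: (@not_exits_card _ _ g).
        by move=> [k kK kg]; apply: ngb; exists k => //; exact: (fsubsetP BK).
      rewrite ler_pdivrMr; last by apply: lt_le_trans N1; rewrite ltr0n.
      by rewrite mulrC -ler_pdivrMr//; apply: le_trans N1.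
    have : 0 <= C2 * (g \in bad)%:R by rewrite mulr_ge0.
    lra.
  rewrite big_split /= -[X in _ + X <= _]mulr_sumr; apply: lerD; last first.
    apply: ler_wpM2l; first by rewrite mulr_ge0.
    apply: (sum_comp_le _ (f := id)).
      by move=> ? ? ? ?.
    by move=> x /E'P[].
  rewrite big_const_seq count_predT iter_addr addr0 -[leLHS]mulr_natr.
  rewrite ler_pM2l ?divr_gt0// ler_nat fsubset_leq_card//.
  by apply/fsubsetP => x /E'P[].
have h5 : C3 * count_in R E bad <= C3 * (eps / 2 / C3 * #|` E|%:R + C4 * bd R K3 E).
  by rewrite ler_pM2l//; exact: inv.
have h6 : C3 * (eps / 2 / C3 * #|` E|%:R + C4 * bd R K3 E) =
    eps / 2 * #|` E|%:R + C3 * C4 * bd R K3 E.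
  by field; rewrite gt_eqF.
have h7 : 0 <= C3 * C4 by rewrite mulr_ge0// ltW.
set a := devi _ _ _ in h1 *; set b := \sum_(g <- E) f g in h1 h2.
set c := \sum_(g <- E') f g in h2 h3.
have h8 : `|a| <= `|a - b| + `|b| by rewrite -{1}(subrK b a) ler_normD.
have h9 : `|b| <= `|b - c| + `|c| by rewrite -{1}(subrK c b) ler_normD.
have hC3 : C3 * count_in R E bad = 2 * C2 * count_in R E bad + count_in R E bad.
  by rewrite /C3 mulrDl mul1r.
lra.
Qed.

(** The statistics can only change at points of the finite sets [fmul (H i) Z]. *)
Lemma dev_finite_change n A A' (Z : {fset G}) : (forall g, g \notin Z -> A g <-> A' g) ->
  exists C, 0 <= C /\ forall E i, (i < n)%N -> `|devi A i E - devi A' i E| <= C.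
Proof.
move=> AA'; exists (\sum_(i <- iota 0 n) #|` fmul (H i) Z|%:R); split=> [|E i i_n].
  exact: sumr_ge0.
have hi : #|` fmul (H i) Z|%:R <= \sum_(i <- iota 0 n) #|` fmul (H i) Z|%:R :> R.
  rewrite (big_rem i)/= ?mem_iota// lerDl; exact: sumr_ge0.
apply: le_trans hi; rewrite /dev -sumrB.
apply: (@le_trans _ _ (count_in R E [set` fmul (H i) Z])).
  rewrite (le_trans (ler_norm_sum _ _ _))//; apply: ler_sum => g _.
  case: (boolP (g \in [set` _])) => [_|gZ].
    by case: (g \in _); case: (g \in _) => /=; rewrite ler_norml; apply/andP; split; lra.
  have nZ h : h \in H i -> (h^-1 * g)%g \notin Z.
    move=> hH; apply/negP => hg; move/negP: gZ; apply; apply/mem_set => /=.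
    by rewrite -(mulVKg h g); apply: mem_fmul.
  have -> : (g \in hits A (H i)) = (g \in hits A' (H i)).
    by apply/idP/idP => /set_mem hg; apply/mem_set => h hH;
     have := hg h hH; have := AA' _ (nZ h hH); tauto.
  by rewrite subrr normr0.
rewrite -[leRHS](count_inT R); apply: (sum_comp_le _ (f := id)); first by move=> ? ? ? ?.
by move=> x _.
Qed.

(* The point is that K'' and C'' do not depend on Q. *)
Lemma good_step n n' eps eps' A K C A' K' C' : 0 < eps ->
  (n <= n')%N -> eps' <= eps -> good n eps A K C -> good n' eps' A' K' C' ->
  exists K'' C'', forall Q : {fset G}, exists A'',
    [/\ exists K1 C1, good n' eps' A'' K1 C1, forall g, g \in Q -> A'' g <-> A g &
        good n (2 * eps) A'' K'' C''].
Proof.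
move=> eps0 nn' ee' [C0 gA] [C'0 gA'].
pose K0 := (K `|` K' `|` inverses H n)%fset.
(* Weight of a bad point: it may count in the boundaries of both parts of [E], and once in the
   gluing. *)
pose C2 := C + C' + 1; have C20 : 0 < C2 by rewrite /C2; lra.
have e1 : 0 < eps / C2 by rewrite divr_gt0.
have [la [K3 [C3 [tl C30 inv]]]] := invariant_tiling idx_inj shape K0 e1.
exists (K `|` K' `|` K3)%fset, (C2 * (C3 + 1)) => Q.
(* A union of whole tiles: any step of [K0] across its border leaves a tile, so the seam consists of
   bad points, which are rare whatever [Q] is. *)
pose Z := (\bigcup_(x <- enum_fset Q) la x)%fset.
have ZP g : g \in Z <-> exists2 x, x \in Q & g \in la x.
  split=> [/bigfcupP[x /andP[xQ _] gx]|[x xQ gx]]; first by exists x.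
  by apply/bigfcupP; exists x => //; rewrite andbT.
have Zla g y : g \in Z -> y \in la g -> y \in Z.
  move=> /ZP[x xQ gx]; rewrite (tiling_eq tl gx) => yx; apply/ZP; by exists x.
pose Af (b : bool) := if b then A else A'.
pose A'' := [set g | Af (g \in Z) g]; exists A''; split.
- have A''Z g : g \notin Z -> A'' g <-> A' g by rewrite /A'' /= => /negbTE ->.
  have [C1 [C10 hC1]] := dev_finite_change n' A''Z.
  exists K', (C' + C1); split=> [|E i i_n]; first by rewrite addr_ge0.
  have := gA' E i i_n; have := hC1 E i i_n; have b0 := bd_ge0 R K' E.
  have : `|devi A'' i E| <= `|devi A'' i E - devi A' i E| + `|devi A' i E|.
    by rewrite -{1}(subrK (devi A' i E) (devi A'' i E)) ler_normD.
  have : 0 <= C1 * bd R K' E by rewrite mulr_ge0.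
  lra.
- move=> g gQ; rewrite /A'' /= (_ : g \in Z)//; apply/ZP; exists g => //.
  exact: tiling_refl tl g.
split=> [|E i i_n]; first by rewrite mulr_ge0 ?addr_ge0// ltW.
pose bad := [set x | exits K0 (la x) x].
have K0sub k : k \in K \/ k \in K' \/ k \in inverses H n -> k \in K0.
  by rewrite !inE => -[->//|[->|->]]; rewrite ?orbT.
have cross k g : k \in K0 -> ((k * g)%g \in Z) != (g \in Z) -> bad g.
  move=> kK0 ne; exists k => //; apply/negP => kg.
  have [gZ|gZ] := boolP (g \in Z); first by rewrite gZ (Zla g) in ne.
  have [kgZ|kgZ] := boolP ((k * g)%g \in Z); last first.
    by rewrite (negbTE gZ) (negbTE kgZ) in ne.
  move/negP: gZ; apply; apply: (Zla _ _ kgZ).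
  by rewrite (tiling_eq tl kg); exact: tiling_refl tl g.
pose f g : R := (g \in hits (Af (g \in Z)) (H i))%:R - mean i.
have h1 : `|devi A'' i E - \sum_(g <- E) f g| <= count_in R E bad.
  apply: le_trans (dev_glue H mean (fun g => g \in Z) Af i E) _.
  apply: count_in_le => g _ [h hH /eqP ne]; apply: cross ne.
  by apply: K0sub; right; right; exact: mem_inverses hH.
pose E1 := [fset g in E | g \in Z]%fset; pose E2 := [fset g in E | g \notin Z]%fset.
have h2 : \sum_(g <- E) f g = devi A i E1 + devi A' i E2.
  rewrite (big_fsetID _ [pred g | g \in Z]) /=; congr (_ + _).
    rewrite /dev !big_seq; apply: eq_bigr => g.
    by rewrite /f !inE => /andP[_ ->].
  rewrite /dev !big_seq; apply: eq_bigr => g.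
  by rewrite /f !inE => /andP[_ /negbTE ->].
have h3 : #|` E1|%:R + #|` E2|%:R = #|` E|%:R :> R.
  rewrite -!(count_inT R) /count_in [RHS](big_fsetID _ [pred g | g \in Z]) /=.
  by [].
have bdE (L E3 : {fset G}) (b : bool) : (forall k, k \in L -> k \in K0) ->
    (forall g, g \in E3 <-> g \in E /\ (g \in Z) = b) ->
    bd R L E3 <= bd R L E + count_in R E bad.
  move=> LK0 E3P; apply: (@le_trans _ _ (count_in R E (exits L E `|` bad))); last exact: count_inU.
  apply: (sum_comp_le _ (f := id)); first by move=> ? ? ? ?.
  move=> x /E3P[xE xb] [k kL kx]; split=> //.
  have [kE|kE] := boolP ((k * x)%g \in E); last by left; exists k.
  right; apply: (cross k); first exact: LK0.
  by apply/negP => /eqP kZ; move/negP: kx; apply; apply/E3P; rewrite kZ.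
have h4 : bd R K E1 <= bd R K E + count_in R E bad.
  apply: (bdE _ _ true) => [k kK|g]; first by apply: K0sub; left.
  by rewrite !inE; split=> [/andP[]|[-> ->]].
have h5 : bd R K' E2 <= bd R K' E + count_in R E bad.
  apply: (bdE _ _ false) => [k kK|g]; first by apply: K0sub; right; left.
  by rewrite !inE; split=> [/andP[-> /negbTE]|[-> ->]].
have i_n' : (i < n')%N by exact: leq_trans nn'.
have h6 := gA E1 i i_n; have h7 := gA' E2 i i_n'.
set KK := (K `|` K' `|` K3)%fset.
have s1 : bd R K E <= bd R KK E by apply: bd_sub; rewrite /KK -fsetUA fsubsetUl.
have s2 : bd R K' E <= bd R KK E.
  by apply: bd_sub; apply/fsubsetP => x; rewrite !inE => ->; rewrite orbT.
have s3 : bd R K3 E <= bd R KK E by apply: bd_sub; exact: fsubsetUr.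
have h8 : count_in R E bad <= eps / C2 * #|` E|%:R + C3 * bd R KK E.
  apply: (le_trans (inv E)); rewrite lerD2l; exact: ler_wpM2l.
have h9 : C2 * count_in R E bad <= eps * #|` E|%:R + C2 * C3 * bd R KK E.
  have -> : eps * #|` E|%:R + C2 * C3 * bd R KK E =
     C2 * (eps / C2 * #|` E|%:R + C3 * bd R KK E) by field; rewrite gt_eqF.
  by rewrite ler_pM2l.
have h10 : eps' * #|` E2|%:R <= eps * #|` E2|%:R by rewrite ler_wpM2r.
have h11 : C * (1 + bd R K E1) <= C * (1 + bd R KK E + count_in R E bad).
  by rewrite ler_wpM2l//; lra.
have h12 : C' * (1 + bd R K' E2) <= C' * (1 + bd R KK E + count_in R E bad).
  by rewrite ler_wpM2l//; lra.
have h13 : eps * #|` E|%:R = eps * #|` E1|%:R + eps * #|` E2|%:R.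
  by rewrite -h3 mulrDr.
have h14 : `|devi A'' i E| <= `|devi A'' i E - \sum_(g <- E) f g| +
    (`|devi A i E1| + `|devi A' i E2|).
  rewrite -{1}(subrK (\sum_(g <- E) f g) (devi A'' i E)) (le_trans (ler_normD _ _))//.
  by rewrite lerD2l h2 ler_normD.
have b0 := bd_ge0 R KK E.
have h15 : 0 <= C2 * C3 by rewrite mulr_ge0// ltW.
have h16 : C2 * (1 + bd R KK E + count_in R E bad) =
  C * (1 + bd R KK E + count_in R E bad) + C' * (1 + bd R KK E + count_in R E bad) +
  (1 + bd R KK E + count_in R E bad) by rewrite /C2; ring.
lra.
Qed.

End Approximation.

(** * Passage to the limit *)

Section Limit.
Variables (R : realType) (G : groupType) (F : nat -> set G).
Hypothesis F_folner : folner_sequence R F.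
Hypothesis G_infinite : infinite_set [set: G].
Variables (H : nat -> {fset G}) (mean : nat -> R).
Local Notation devi := (dev H mean).
Local Notation good := (good H mean).
Hypothesis good_ex : forall n eps, 0 < eps -> exists A K C, good n eps A K C.
Hypothesis good_next : forall n n' eps eps' A K C A' K' C', 0 < eps ->
  (n <= n')%N -> eps' <= eps -> good n eps A K C -> good n' eps' A' K' C' ->
  exists K'' C'', forall Q : {fset G}, exists A'',
    [/\ exists K1 C1, good n' eps' A'' K1 C1, forall g, g \in Q -> A'' g <-> A g &
        good n (2 * eps) A'' K'' C''].

Local Notation tol n := (n.+1%:R^-1 : R).

(** The terms [C] and [C * bd] each fall below [eps / 2 * #|F_N|]. The threshold [M] is chosen
    before [A]. *)
Lemma good_folner n eps (K : {fset G}) (C : R) : 0 < eps ->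
  exists M, forall A, good n (2 * eps) A K C -> forall N i, (M <= N)%N -> (i < n)%N ->
    `|devi A i (fF F N)| <= 3 * eps * #|` fF F N|%:R.
Proof.
move=> eps0; have [C0|C0] := leP 0 C; last first.
  by exists 0%N => A [C0']; move: C0; rewrite ltNge C0'.
have C10 : 0 < 2 * (C + 1) by lra.
pose delta := eps / (2 * (C + 1)).
have delta0 : 0 < delta by rewrite divr_gt0.
have h1 := folner_bd_near F_folner K delta0.
have h2 := folner_card_near F_folner G_infinite (Num.truncn (2 * (C + 1) / eps)).+1.
have [M _ HM] : \forall N \near \oo, bd R K (fF F N) <= delta * #|` fF F N|%:R /\
    (Num.truncn (2 * (C + 1) / eps)).+1%:R <= #|` fF F N|%:R :> R.
  by apply: filterS2 h1 h2.
exists M => A [_ gA] N i MN i_n; have [bdN cN] := HM N MN.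
apply: (le_trans (gA (fF F N) i i_n)).
have c1 : 2 * (C + 1) <= eps * #|` fF F N|%:R.
  rewrite [leRHS]mulrC -ler_pdivrMr//; apply: le_trans cN; exact/ltW/truncnS_gt.
have c2 : C * bd R K (fF F N) <= C * (delta * #|` fF F N|%:R) by rewrite ler_wpM2l.
have c3 : (C + 1) * (delta * #|` fF F N|%:R) = eps / 2 * #|` fF F N|%:R.
  by rewrite /delta; field; rewrite gt_eqF//; lra.
have c4 : 0 <= delta * #|` fF F N|%:R by rewrite mulr_ge0// ltW.
lra.
Qed.

(** [stage_A] is the current set, frozen on [stage_Q]. From [stage_M] on, admissible extensions have
    their first [stage_n] statistics under control. *)
Record stage := Stage { stage_n : nat ; stage_A : set G ; stage_M : nat ; stage_Q : {fset G} }.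

Definition extends (s : stage) (A' : set G) (Q : {fset G}) :=
  [/\ exists K C, good (stage_n s).+1 (tol (stage_n s).+1) A' K C,
      forall g, g \in Q -> A' g <-> stage_A s g &
      forall N i, (stage_M s <= N)%N -> (i < stage_n s)%N ->
        `|devi A' i (fF F N)| <= 3 * tol (stage_n s) * #|` fF F N|%:R].

Definition stage_ok (s : stage) := forall Q, exists A', extends s A' Q.

(** The last clause freezes every point that the relevant statistics read from [F N] for [N] below
    the new threshold, so later stages do not alter their values there. *)
Definition stage_next (s s' : stage) :=
  [/\ stage_n s' = (stage_n s).+1, (stage_M s < stage_M s')%N,
      (stage_Q s `<=` stage_Q s')%fset, extends s (stage_A s') (stage_Q s) &
      forall N i g h, (N < stage_M s')%N -> (i < stage_n s')%N -> g \in fF F N ->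
        h \in H i -> (h^-1 * g)%g \in stage_Q s'].

(** [good_next] gives constants independent of [Q], so [good_folner] fixes the threshold before [Q]
    is known. The bound [m < M] makes thresholds increase. *)
Lemma stage_of n A m : (exists K C, good n (tol n) A K C) ->
  exists2 M, (m < M)%N & forall Q, stage_ok (Stage n A M Q).
Proof.
move=> [K [C gA]].
have tol0 k : 0 < tol k by rewrite invr_gt0 ltr0n.
have [A' [K' [C' gA']]] := good_ex n.+1 (tol0 n.+1).
have tolS : tol n.+1 <= tol n.
  by rewrite lef_pV2 ?posrE ?ltr0n// ler_nat.
have [K'' [C'' step]] := good_next (tol0 n) (leqnSn n) tolS gA gA'.
have [M HM] := good_folner n K'' C'' (tol0 n).
exists (maxn M m.+1) => [|Q Q']; first by rewrite leq_max ltnSn orbT.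
have [A'' [gA'' agr g2]] := step Q'; exists A''; split=> //= N i.
by rewrite geq_max => /andP[MN _]; exact: HM.
Qed.

Lemma stage_step s : stage_ok s -> exists2 s', stage_ok s' & stage_next s s'.
Proof.
move=> ok; have [A' [gA' agr bnd]] := ok (stage_Q s).
have [M MM okM] := stage_of (stage_M s) gA'.
pose Q' := (stage_Q s `|`
  \bigcup_(N <- iota 0 M) fmul (inverses H (stage_n s).+1) (fF F N))%fset.
exists (Stage (stage_n s).+1 A' M Q'); first exact: okM.
split=> //=; first exact: fsubsetUl.
move=> N i g h NM i_n gF hH; rewrite inE; apply/orP; right.
apply/bigfcupP; exists N; first by rewrite andbT mem_iota.
by apply: mem_fmul => //; exact: mem_inverses hH.
Qed.

(** For [N] between the thresholds of stages [j] and [j.+1], [F N] sees the limit set exactly as it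
    sees the set of stage [j.+1], an extension of stage [j] with error at most [3 * tol j]. *)
Lemma generic_set_exists : exists A : set G, forall i (e : R), 0 < e ->
  \forall N \near \oo, `|devi A i (fF F N)| <= e * #|` fF F N|%:R.
Proof.
have [A0 gA0] : exists A, exists K C, good 0 (tol 0) A K C.
  by apply: good_ex; rewrite invr_gt0.
have [M0 _ ok0] := stage_of 0 gA0.
pose s0 := exist stage_ok (Stage 0 A0 M0 fset0) (ok0 fset0).
have [st [st0 stS]] : {f : nat -> {s | stage_ok s} |
    f 0%N = s0 /\ forall j, stage_next (sval (f j)) (sval (f j.+1))}.
  apply: (@dependent_choice _ (fun s s' => stage_next (sval s) (sval s'))).
  move=> [s ok]; have /cid2[s' ok' nx] := stage_step ok.
  by exists (exist _ s' ok').
pose S j := sval (st j).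
have Sn j : stage_n (S j) = j.
  elim: j => [|j IH]; first by rewrite /S st0.
  by have [-> _ _ _ _] := stS j; rewrite -/(S j) IH.
have MS j : (stage_M (S j) < stage_M (S j.+1))%N by have [] := stS j.
have Mge j : (j <= stage_M (S j))%N.
  by elim: j => // j IH; exact: leq_ltn_trans IH (MS j).
have QS j k : (j <= k)%N -> (stage_Q (S j) `<=` stage_Q (S k))%fset.
  move=> /subnK <-; elim: (k - j)%N => [|l IH]; first exact: fsubset_refl.
  by apply: (fsubset_trans IH); rewrite addSn; have [] := stS (l + j)%N.
have agree j k g : (j <= k)%N -> g \in stage_Q (S j) ->
    stage_A (S k) g <-> stage_A (S j) g.
  move=> jk gQ; rewrite -(subnK jk); elim: (k - j)%N => [//|l IH].
  rewrite addSn -IH; have [_ _ _ [_ agr _] _] := stS (l + j)%N.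
  by apply: agr; apply: (fsubsetP (QS j _ _)) gQ; exact: leq_addl.
pose A : set G := [set g | exists2 j, g \in stage_Q (S j) & stage_A (S j) g].
have AS j g : g \in stage_Q (S j) -> A g <-> stage_A (S j) g.
  move=> gQ; split=> [[k gk Ak]|Aj]; last by exists j.
  have [jk|/ltnW kj] := leqP j k; first by apply/(agree j k g).
  by apply/(agree k j g).
exists A => i e e0.
(* From [j0] on, statistic [i] is among those controlled and [3 * tol j] is below [e]. *)
pose j0 := maxn i.+1 (Num.truncn (3 / e)).+1.
exists (stage_M (S j0)) => // N /= j0N.
have exk : exists k, (N < stage_M (S k))%N by exists N.+1; exact: Mge.
(* The first threshold exceeding [N] belongs to a stage [j.+1]; it cannot be that of stage 0, since
   [N] is past the threshold of [j0]. *)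
case: (ex_minnP exk) => -[|j] Nj minj.
  have : (stage_M (S 0) <= stage_M (S j0))%N.
    elim: j0 {j0N} => // j IH; exact: leq_trans IH (ltnW (MS j)).
  by move=> /leq_trans/(_ j0N); rewrite leqNgt Nj.
have jN : (stage_M (S j) <= N)%N.
  by rewrite leqNgt; apply/negP => /minj; rewrite ltnn.
have j0j : (j0 <= j)%N.
  rewrite leqNgt; apply/negP => jj0.
  have : (stage_M (S j.+1) <= stage_M (S j0))%N.
    move: jj0 => /subnK <-; elim: (j0 - j.+1)%N => // l IH.
    by rewrite addSn; exact: leq_trans IH (ltnW (MS _)).
  by move=> /leq_trans/(_ j0N); rewrite leqNgt Nj.
have i_j : (i < j)%N by apply: leq_trans j0j; rewrite leq_maxl.
have [_ _ _ [_ _ bnd] cover] := stS j.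
have -> : devi A i (fF F N) = devi (stage_A (S j.+1)) i (fF F N).
  rewrite /dev !big_seq; apply: eq_bigr => g gF; congr (_%:R - _).
  congr nat_of_bool; have cov h (hH : h \in H i) : (h^-1 * g)%g \in stage_Q (S j.+1).
    by apply: (cover N i) => //; rewrite -/(S j.+1) Sn ltnS ltnW.
  by apply/idP/idP => /set_mem hg; apply/mem_set => h hH;
     apply/(AS j.+1 _ (cov h hH)); exact: hg.
apply: (le_trans (bnd N i _ _)) => //; first by rewrite -/(S j) Sn.
rewrite -/(S j) Sn ler_wpM2r// ler_pdivrMr ?ltr0n//.
rewrite [leRHS]mulrC -ler_pdivrMr// ltW// (lt_le_trans (truncnS_gt _))//.
rewrite ler_nat; apply: leqW; apply: leq_trans j0j; exact: leq_maxr.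
Qed.

End Limit.

(** * Enumeration of finite sets and conclusion *)

Lemma enumerate_fset (G : choiceType) (idx : G -> nat) : injective idx ->
  exists H : nat -> {fset G}, forall Hs, exists i, H i = Hs.
Proof.
move=> idx_inj; pose code (Hs : {fset G}) := choice.pickle (map idx (enum_fset Hs)).
have code_inj Hs Hs' : code Hs = code Hs' -> Hs = Hs'.
  move=> /(pcan_inj choice.pickleK)/(inj_map idx_inj) e.
  by apply/fsetP => x; rewrite -[x \in Hs]/(x \in enum_fset Hs) e.
have : forall i, exists Hs, forall Hs', code Hs' = i -> Hs = Hs'.
  move=> i; have [[Hs e]|ne] := pselect (exists Hs, code Hs = i).
    by exists Hs => Hs' e'; apply: code_inj; rewrite e e'.
  by exists fset0 => Hs' e'; case: ne; exists Hs'.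
by move=> /choice[H HP]; exists H => Hs; exists (code Hs); exact: HP.
Qed.

Theorem theorem1p6 (R : realType) (G : groupType)
    (G_countable : countable [set: G]) (G_infinite : infinite_set [set: G])
    (F : nat -> set G) (F_folner : folner_sequence R F)
    (d : measure_display) (X : measurableType d) (mu : probability X R)
    (T : G -> X -> X) (T_mp : measure_preserving_action mu T)
    (B : set X) (B_measurable : measurable B) :
  exists A : set G, forall (k : nat) (h : 'I_k -> G), (0 < k)%N ->
    density_exists R F (\bigcap_i translate (h i) A) /\
    (density R F (\bigcap_i translate (h i) A))%:E =
      mu (\bigcap_i (T (h i) @` B)).
Proof.
have /countable_injP[idx idxP] := G_countable.
have idx_inj : injective idx by move=> x y; apply: idxP; rewrite in_setT.
have [H H_surj] := enumerate_fset idx_inj.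
have shape := folner_shape F_folner.
have large n : exists K : {fset G}, (n <= #|` K|)%N.
  by have [K _ Kn] := infinite_set_fset n G_infinite; exists K.
have mean01 := cylinder_mean01 T_mp B_measurable H.
have pattern := pattern_exists idx_inj shape T_mp B_measurable H.
have [A genA] := generic_set_exists F_folner G_infinite
  (good_exists idx_inj shape large mean01 pattern)
  (good_step idx_inj shape (H := H) (mean := cylinder_mean mu T B H)).
exists A => k h _.
have [i Hi] := H_surj [fset h j | j : 'I_k]%fset.
have memH j : h j \in H i by rewrite Hi; apply/imfsetP; exists j.
have HP x : x \in H i -> exists j, x = h j.
  by rewrite Hi => /imfsetP[j _ ->]; exists j.
set E := \bigcap_i translate (h i) A.
have EE : E = hits A (H i).
  apply/seteqP; split=> [g Eg x /HP[j ->]|g hg j _].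
    by have [y Ay <-] := Eg j Logic.I; rewrite mulKg.
  by exists ((h j)^-1 * g)%g; [exact: hg|rewrite mulVKg].
(* Each [T h] is invertible, so the image of [B] under [T h] is its preimage under the action of
   [h^-1]. *)
have CC : \bigcap_i (T (h i) @` B) = cylinder T B (H i).
  apply/seteqP; split=> [y Cy x /HP[j ->]|y hy j _].
    have [z Bz <-] := Cy j Logic.I.
    by rewrite -(mp_actionM T_mp) mulVg (mp_action1 T_mp).
  exists (T (h j)^-1%g y); first exact: hy.
  by rewrite -(mp_actionM T_mp) mulgV (mp_action1 T_mp).
have lim : density_seq R F E @ \oo --> cylinder_mean mu T B H i.
  apply/cvgrPdist_le => e e0; apply: filterS (genA i e e0) => N.
  have F0 := fF_card_gt0 F_folner N.
  (* The deviation on [F N] is the density error multiplied by the size of [F N]. *)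
  have -> : dev H (cylinder_mean mu T B H) A i (fF F N) =
      (density_seq R F E N - cylinder_mean mu T B H i) * #|` fF F N|%:R.
    rewrite mulrBl /density_seq /card_set -/(fF F N) divfK ?gt_eqF//.
    rewrite /dev sumrB big_const_seq count_predT iter_addr addr0 mulr_natr.
    congr (_ - _); rewrite -(count_inT R) -EE.
    have finEF : finite_set (E `&` F N).
      by apply: finite_setIr; exact: folner_finite F_folner N.
    have idI (L : {fset G}) : {in L &, injective (@id G)} by move=> ? ? ? ?.
    apply/eqP; rewrite eq_le; apply/andP; split.
      apply: (sum_comp_le _ (@idI _)) => g; rewrite (mem_fF F_folner) => /set_mem Fg Eg.
      by split=> //; rewrite in_fset_set//; apply/mem_set.
    apply: (sum_comp_le _ (@idI _)) => g; rewrite in_fset_set// => /set_mem[Eg Fg] _.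
    by split=> //; rewrite (mem_fF F_folner); apply/mem_set.
  by rewrite normrM normr_nat ler_pM2r// distrC.
split; first by apply/cvg_ex; exists (cylinder_mean mu T B H i).
rewrite /density (cvg_lim _ lim)// CC /cylinder_mean fineK//.
exact: (fin_num_measure mu _ (measurable_cylinder T_mp B_measurable (H i))).
Qed.
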